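(* Let $\{\xi_n, n<\infty\}$ be the controlled Markov chain on the finite state space $S$ with absorbing set $\partial S\subset S$, transition probabilities $p(x,y|r_1,r_2)$, running cost $c(x,r_1,r_2)$, continuous in $r_1$ and $r_2$, and terminal cost $g$, as described in the context. Assume that there are an integer $n\ge 1$ and a real number $\gamma>0$ such that, for every $x\in S$ and every admissible control policy, $$P(\xi_n\in\partial S \mid \xi_0=x,\ u_{1,k},u_{2,k},\ k\le n)\ \ge\ \gamma .$$ Assume moreover that either of the following two conditions holds: (H1) $p(x,y|r_1,r_2)$ and $c(x,r_1,r_2)$ are continuous and separable in $r_1$ and $r_2$; (H2) $p(x,y|r_1,r_2)$ and $c(x,r_1,r_2)$ are convex-concave with respect to $(r_1,r_2)$. Let $V^+$ and $V^-$ be the upper and lower values of the game defined in the context. Then there exists a saddle point, that is, $$V^+(x)=V^-(x)\quad\text{for all } x\in S .$$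
   Context: Two-player zero-sum discrete Markov game. $S$ is a finite set and $\partial S\subset S$ is a collection of absorbing states. The control spaces $U_1,U_2$ of players 1 and 2 are compact subsets of $\mathbb{R}$. $\{\xi_n\}$ is a controlled discrete-time Markov chain on $S$ with time-independent transition probabilities $$p(x,y|r_1,r_2)=P\{\xi_{n+1}=y\mid \xi_n=x,\ u_{1,n}=r_1,\ u_{2,n}=r_2\},$$ where $u_{i,n}\in U_i$ is the decision of player $i$ at time $n$. A control policy $\{(u_{1,n},u_{2,n})\}$ is admissible if $P\{\xi_{n+1}=y\mid \xi_k,u_{1,k},u_{2,k},k\le n\}=p(\xi_n,y|u_{1,n},u_{2,n})$. The running cost is $c:S\times U_1\times U_2\to[0,\infty)$ and the terminal cost is $g:S\to[0,\infty)$. For initial state $\xi_0=x$ and an admissible policy $(u_1,u_2)$, $$W(x,u_1,u_2)=E_x^{u_1,u_2}\Big[\sum_{n=0}^{N-1}c(\xi_n,u_{1,n},u_{2,n})+g(\xi_N)\Big],\qquad N=\min\{n:\xi_n\in\partial S\}.$$ Player 1 minimizes and player 2 maximizes. Information structure. $\mathcal{U}_i(1)$ is the set of admissible controls of player $i$ when player $i$ goes first: $u_i\in\mathcal{U}_i(1)$ means there are measurable $U_i$-valued functions $F_n$ with $u_{i,n}=F_n(\xi_k,k\le n;\ u_{1,k},u_{2,k},k<n)$. $\mathcal{U}_i(2)$ is the set of admissible controls of player $i$ when player $i$ goes last: there are measurable $U_i$-valued functions $\widetilde F_n$ with $u_{i,n}=\widetilde F_n(\xi_k,k\le n;\ u_{i,k},k<n;\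 u_{j,k},k\le n,\ j\ne i)$. Upper and lower values: $$V^+(x)=\min_{u_1\in\mathcal{U}_1(1)}\max_{u_2\in\mathcal{U}_2(2)}W(x,u_1,u_2),\qquad V^-(x)=\max_{u_2\in\mathcal{U}_2(1)}\min_{u_1\in\mathcal{U}_1(2)}W(x,u_1,u_2).$$ A function $f(r_1,r_2)$ on $U_1\times U_2$ is separable in $r_1$ and $r_2$ if $f(r_1,r_2)=f^1(r_1)+f^2(r_2)$ for some functions $f^1,f^2$. It is convex-concave with respect to $(r_1,r_2)$ if $f(\cdot,r_2)$ is convex and $f(r_1,\cdot)$ is concave. *)

(* Defs.v *)
From HB Require Import structures.
From mathcomp Require Import all_boot all_order all_algebra.
From mathcomp Require Import all_classical all_reals all_analysis.
Set Implicit Arguments.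
Unset Strict Implicit.
Unset Printing Implicit Defensive.
Import Order.TTheory GRing.Theory Num.Theory.
Import numFieldNormedType.Exports.
Local Open Scope classical_set_scope.
Local Open Scope ring_scope.

Section MarkovGame.
Context {R : realType} {S : finType}.
Variables (dS : {set S}) (U1 U2 : set R).
Variables (p : S -> S -> R -> R -> R) (c : S -> R -> R -> R) (g : S -> R).

Definition transition_probability :=
  forall x r1 r2, U1 r1 -> U2 r2 ->
    (forall y, 0 <= p x y r1 r2) /\ \sum_(y : S) p x y r1 r2 = 1.

Definition absorbing_set :=
  forall x r1 r2, x \in dS -> U1 r1 -> U2 r2 -> p x x r1 r2 = 1.

Section ControlledChain.
Context {d : measure_display} {T : measurableType d}.
Variables (P : probability T R) (xi : nat -> T -> S) (u1 u2 : nat -> T -> R).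

(* [<<s history_events n >>] is the sigma-algebra generated by
   xi_k, u_{1,k}, u_{2,k} for k <= n. *)
Definition history_events (n : nat) : set (set T) :=
  [set A | exists2 k : nat, (k <= n)%N &
     [\/ exists s : S, A = xi k @^-1` [set s],
         exists2 B : set R, measurable B & A = u1 k @^-1` B |
         exists2 B : set R, measurable B & A = u2 k @^-1` B]].

(* The last clause states that p(xi_n, y | u_{1,n}, u_{2,n}) is a version of
   the conditional probability of {xi_{n+1} = y} given the history up to n. *)
Definition admissible :=
  [/\ forall n s, measurable (xi n @^-1` [set s]),
      forall n, measurable_fun setT (u1 n) /\ measurable_fun setT (u2 n),
      forall n w, U1 (u1 n w) /\ U2 (u2 n w) &
      forall n y A, <<s history_events n >> A ->
        P (A `&` xi n.+1 @^-1` [set y]) =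
        (\int[P]_(w in A) (p (xi n w) y (u1 n w) (u2 n w))%:E)%E].

End ControlledChain.

(* The cost along one trajectory. If the trajectory never reaches [dS], there
   is no terminal state and only the running costs are counted. *)
Definition total_cost (x : nat -> S) (r1 r2 : nat -> R) : \bar R :=
  match pselect (exists n, x n \in dS) with
  | left hit => let N := ex_minn hit in
      (\sum_(k < N) c (x k) (r1 k) (r2 k) + g (x N))%:E
  | right _ => (\sum_(0 <= k <oo) (c (x k) (r1 k) (r2 k))%:E)%E
  end.

(* The decision rules of one player: the arguments are the states up to time n,
   the player's own controls before n, and the opponent's controls, before n
   if the player goes first ([last = false]) and up to n if the player goes
   last ([last = true]). *)
Definition rules (last : bool) : Type :=
  forall n : nat, n.+1.-tuple S -> n.-tuple R -> (n + last)%N.-tuple R -> R.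

(* Since S is finite, joint measurability reduces to measurability in the
   controls for each fixed sequence of states. *)
Definition controls (last : bool) (U : set R) : set (rules last) :=
  [set F | forall n (xs : n.+1.-tuple S),
     measurable_fun setT
       (fun r : n.-tuple R * (n + last)%N.-tuple R => F n xs r.1 r.2) /\
     forall own opp, U (F n xs own opp)].
Arguments controls : clear implicits.

Definition follows (last : bool) (F : rules last) (T : Type)
    (xi : nat -> T -> S) (own opp : nat -> T -> R) :=
  forall n w, own n w = F n [tuple xi k w | k < n.+1] [tuple own k w | k < n]
                            [tuple opp k w | k < n + last].

(* W(x,u1,u2), when one player uses rules with [last = false] and the other
   one rules with [last = true]. The rules are then deterministic functions of
   the past, so that with p they determine the law of (xi, u1, u2); this law
   exists, and the set below has exactly one element, the expected cost. *)
Definition W (last1 last2 : bool) (x : S) (F : rules last1) (G : rules last2)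
    : \bar R :=
  ereal_sup [set e | exists (d : measure_display) (T : measurableType d)
      (P : probability T R) (xi : nat -> T -> S) (u1 u2 : nat -> T -> R),
    [/\ admissible P xi u1 u2,
        forall w, xi 0%N w = x,
        follows F xi u1 u2,
        follows G xi u2 u1 &
        e = (\int[P]_w total_cost (xi ^~ w) (u1 ^~ w) (u2 ^~ w))%E]].

(* The best cost the opponent can secure against a player who goes first with
   the given rules. *)
Definition worst_cost1 (x : S) (F : rules false) : \bar R :=
  ereal_sup [set W x F G | G in controls true U2].

Definition worst_cost2 (x : S) (G : rules false) : \bar R :=
  ereal_inf [set W x F G | F in controls true U1].

Definition upper_value (x : S) : \bar R :=
  ereal_inf [set worst_cost1 x F | F in controls false U1].

Definition lower_value (x : S) : \bar R :=
  ereal_sup [set worst_cost2 x G | G in controls false U2].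

(* The conditional probability of absorption given xi_0 = x and the policy in
   use is the probability of absorption under the law of the chain started at x
   and controlled by that policy. *)
Definition uniformly_absorbing (n : nat) (gamma : R) :=
  forall (x : S) (d : measure_display) (T : measurableType d)
    (P : probability T R) (xi : nat -> T -> S) (u1 u2 : nat -> T -> R),
  admissible P xi u1 u2 -> (forall w, xi 0%N w = x) ->
  (gamma%:E <= P [set w | xi n w \in dS])%E.

Definition continuous_on_controls (f : R -> R -> R) :=
  {within U1 `*` U2, continuous (fun r : R * R => f r.1 r.2)}.

Definition separable (f : R -> R -> R) :=
  exists f1 f2 : R -> R,
    forall r1 r2, U1 r1 -> U2 r2 -> f r1 r2 = f1 r1 + f2 r2.

(* Convexity and concavity are only meaningful on convex sets of controls. *)
Definition convex_concave (f : R -> R -> R) :=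
  [/\ convex_set (U1 : set R^o), convex_set (U2 : set R^o),
      forall r2, U2 r2 -> convex_function (U1 : set R^o) (fun r1 => f r1 r2) &
      forall r1, U1 r1 ->
        convex_function (U2 : set R^o) (fun r2 => - f r1 r2)].

Definition H1 :=
  (forall x y, continuous_on_controls (p x y) /\ separable (p x y)) /\
  (forall x, continuous_on_controls (c x) /\ separable (c x)).

Definition H2 :=
  (forall x y, convex_concave (p x y)) /\ (forall x, convex_concave (c x)).

End MarkovGame.

Arguments controls {R S} last U.

(* Main.v *)
Require Import Defs.
From HB Require Import structures.
From mathcomp Require Import all_boot all_order all_algebra.
From mathcomp Require Import all_classical all_reals all_analysis.
From mathcomp Require Import measurable_realfun ring lra.
Set Implicit Arguments.
Unset Strict Implicit.
Unset Printing Implicit Defensive.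
Import Order.TTheory GRing.Theory Num.Theory.
Import numFieldNormedType.Exports.
Local Open Scope classical_set_scope.
Local Open Scope ring_scope.

(** Both players have optimal stationary rules, read off from a function [V]
    that solves the Isaacs equation: [V] is the terminal cost on the absorbing
    set, and elsewhere [V x] is the value of the one-stage game with payoff
    [c x r1 r2 + \sum_y p x y r1 r2 * V y]. Four facts make this work.

    The one-stage game has a saddle point for every nonnegative [V]
    ([stage_saddle]). If the data are separable, the two players optimize
    separately. In the convex-concave case this is the minimax theorem for
    compact intervals ([convex_concave_saddle]), proved here by Helly's theorem
    on the line. The transition probabilities are jointly continuous in both
    cases, because convex-concave functions that sum to one are affine in each
    variable ([convex_p_continuous]).

    Absorption yields a potential [phi], at least one off the absorbing set,
    that every pair of controls contracts in one step by a factor [rho < 1]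
    ([absorption_potential]): it is the sum over [m < n] of the largest
    probabilities of not being absorbed after [m] steps. Its decrease is governed
    by the same quantity at time [n], which the absorption hypothesis bounds once
    a controlled chain that attains it has been constructed
    ([controlled_chain_exists]).

    Value iteration from the terminal cost is monotone and, because of [phi],
    bounded, so it converges to a solution [V] of the Isaacs equation
    ([isaacs_fixpoint]).

    Finally, stop collecting costs at time [m] and pay [V] at the current state
    instead. If player 1 uses the saddle controls, the expected total is
    nonincreasing in [m], whatever player 2 does; if player 2 uses them, it is
    nondecreasing. The payment left at time [m] is nonnegative, and at most a
    constant times [rho ^+ m], so that the first player guarantees at most
    [V x] ([total_cost_le]) and the second at least [V x] ([total_cost_ge]).
    The latter bounds a supremum over chains from below, so a chain that follows
    the given rules has to exist; this is again [controlled_chain_exists]. A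
    stationary rule is available both to the player who goes first and to the
    player who goes last, hence the two bounds close the gap between the upper
    and the lower value. *)

(** * Minimax theorem on compact intervals *)

Section Minimax.
Context {R : realType}.
Implicit Types (U : set R) (h : R -> R) (f : R -> R -> R).

Definition saddle_point (U1 U2 : set R) f (a b : R) :=
  [/\ U1 a, U2 b, forall r2, U2 r2 -> f a r2 <= f a b &
      forall r1, U1 r1 -> f a b <= f r1 b].

Lemma compact_argmax (T : topologicalType) (A : set T) (h : T -> R) :
  compact A -> A !=set0 -> {within A, continuous h} ->
  exists2 a, A a & forall x, A x -> h x <= h a.
Proof.
move=> cA A0 ch; have [a] := compact_EVT_max A0 cA ch.
by rewrite inE => Aa amax; exists a => // x Ax; apply: amax; rewrite inE.
Qed.

Lemma compact_argmin (T : topologicalType) (A : set T) (h : T -> R) :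
  compact A -> A !=set0 -> {within A, continuous h} ->
  exists2 a, A a & forall x, A x -> h a <= h x.
Proof.
move=> cA A0 ch; have [a] := compact_EVT_min A0 cA ch.
by rewrite inE => Aa amax; exists a => // x Ax; apply: amax; rewrite inE.
Qed.

(** Serves twice: for the compactness of superlevel sets, and for the lower
    semicontinuity of a supremum of continuous functions. *)
Lemma cluster_superlevel U h (F : set_system R) (a m : R) :
  {within U, continuous h} -> Filter F -> U a -> cluster F a ->
  F U -> (forall e, 0 < e -> F [set r | m - e <= h r]) -> m <= h a.
Proof.
move=> /subspace_continuousP ch FF Ua aF FU Fm.
rewrite leNgt; apply/negP => ham; pose e := (m - h a) / 2.
have e0 : 0 < e by rewrite divr_gt0// subr_gt0.
have /ch := Ua => /cvgrPdist_lt/(_ e e0); rewrite near_withinE => nh.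
have [r [[Ur hr] hd]] := aF _ _ (filterI FU (Fm _ e0)) nh.
have := hd Ur; rewrite ltr_norml => /andP[+ _]; move: hr.
rewrite /= /e /from_subspace; lra.
Qed.

Lemma compact_superlevel U h m :
  compact U -> {within U, continuous h} -> compact (U `&` [set y | m <= h y]).
Proof.
move=> cU ch F PF FB.
have FU : F U by apply: filterS FB => y [].
have [a [Ua aF]] := cU _ PF FU.
exists a; split=> //; split => //; apply: (cluster_superlevel ch _ Ua aF FU).
by move=> e e0; apply: filterS FB => y [_ /=]; lra.
Qed.

(** The supremum of [f r] over [U2] is lower semicontinuous in [r], so its
    infimum [m] over the compact set [U1] is attained: [a] is a cluster point of
    controls whose guaranteed levels decrease to [m]. *)
Lemma minimax_strategy (U1 U2 : set R) f :
  compact U1 -> U1 !=set0 -> compact U2 -> U2 !=set0 ->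
  (forall y, U2 y -> {within U1, continuous (f ^~ y)}) ->
  (forall r, U1 r -> {within U2, continuous (f r)}) ->
  exists a m, [/\ U1 a, forall y, U2 y -> f a y <= m &
    forall r, U1 r -> exists2 y, U2 y & m <= f r y].
Proof.
move=> cU1 [r0 Ur0] cU2 [y0 Uy0] cf1 cf2.
pose E := [set s | exists2 r, U1 r & forall y, U2 y -> f r y <= s].
have U1n0 : U1 !=set0 by exists r0.
have U2n0 : U2 !=set0 by exists y0.
have ME r : U1 r -> exists2 y, U2 y & E (f r y).
  move=> Ur; have [y Uy ymax] := compact_argmax cU2 U2n0 (cf2 _ Ur).
  by exists y => //; rewrite /E /=; exists r.
have En0 : E !=set0 by have [y _ Ey] := ME _ Ur0; exists (f r0 y).
have [rmin Urmin rminP] := compact_argmin cU1 U1n0 (cf1 _ Uy0).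
have lE : has_inf E.
  split=> //; exists (f rmin y0) => s [r Ur rs].
  exact: le_trans (rminP _ Ur) (rs _ Uy0).
pose m := inf E.
have near_opt s : exists r, m < s -> U1 r /\ forall y, U2 y -> f r y <= s.
  have [ms|nms] := pselect (m < s); last by exists 0.
  have e0 : 0 < s - m by rewrite subr_gt0.
  have [s' [r Ur rs'] s's] := inf_adherent e0 lE.
  exists r => _; split=> // y Uy; apply: le_trans (rs' _ Uy) (ltW _).
  by rewrite addrC subrK in s's.
have [r rP] := choice near_opt.
have FU : \forall s \near m^'+, U1 (r s).
  by near=> s; have [|] := rP s; first by near: s; exact: nbhs_right_gt.
have [a [Ua aF]] := cU1 (r @ m^'+) _ FU.
exists a, m; split => //.
  move=> y Uy; rewrite -lerN2.
  apply: (@cluster_superlevel U1 (fun r => - f r y) (r @ m^'+)) => //.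
  - by move=> x; apply: continuousN; exact: cf1.
  - move=> e e0; change (\forall s \near m^'+, - m - e <= - f (r s) y).
    near=> s.
    have sm : s < m + e by near: s; apply: nbhs_right_lt; rewrite ltrDl.
    have [|] := rP s; first by near: s; exact: nbhs_right_gt.
    by move=> _ /(_ _ Uy); move: sm; lra.
move=> r1 Ur1; have [y Uy Ey] := ME _ Ur1; exists y => //.
by apply: ge_inf => //; case: lE.
Unshelve. all: by end_near.
Qed.

Lemma between_conv (x y z : R) : x <= z -> z <= y ->
  exists2 t, 0 <= t <= 1 & z = t * x + (1 - t) * y.
Proof.
move=> xz zy; have [xy|xy] := eqVneq x y.
  by exists 0; rewrite ?lexx ?ler01//; move: xz zy; rewrite xy; lra.
have d0 : 0 < y - x by rewrite subr_gt0 lt_neqAle xy (le_trans xz).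
exists ((y - z) / (y - x)); last by field; rewrite subr_eq0 eq_sym.
apply/andP; split; first by rewrite divr_ge0 ?subr_ge0// ltW// -subr_gt0.
by rewrite ler_pdivrMr// mul1r; lra.
Qed.

Definition segment_closed U := forall x y t, U x -> U y -> 0 <= t <= 1 ->
  U (t * x + (1 - t) * y).

Definition convex_on U h := forall x y t, U x -> U y -> 0 <= t <= 1 ->
  h (t * x + (1 - t) * y) <= t * h x + (1 - t) * h y.

Lemma segment_closed_between U x y z :
  segment_closed U -> U x -> U y -> x <= z -> z <= y -> U z.
Proof.
by move=> cU Ux Uy xz zy; have [t t01 ->] := between_conv xz zy; exact: cU.
Qed.

Lemma concave_between U h x y z m : convex_on U (fun r => - h r) ->
  U x -> U y -> x <= z -> z <= y -> m <= h x -> m <= h y -> m <= h z.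
Proof.
move=> ch Ux Uy xz zy mx my; have [t /[dup] t01 /andP[t0 t1] ->] := between_conv xz zy.
have := ch _ _ _ Ux Uy t01; set w := h _; nra.
Qed.

(** Helly's theorem on the line. Since the intervals meet pairwise, every left
    end point lies below every right end point, and the supremum of the left end
    points belongs to all of them. *)
Lemma pairwise_common_point (I : Type) (D : set I) (B : I -> set R) :
  D !=set0 -> (forall i, D i -> compact (B i)) ->
  (forall i x y z, D i -> B i x -> B i y -> x <= z -> z <= y -> B i z) ->
  (forall i j, D i -> D j -> B i `&` B j !=set0) ->
  exists y, forall i, D i -> B i y.
Proof.
move=> [i0 Di0] cB iB BB.
have idc (A : set R) : {within A, continuous (fun x : R => x)}.
  by apply: continuous_subspaceT => x; exact: cvg_id.
have B0 i : D i -> B i !=set0.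
  by move=> Di; have [y []] := BB _ _ Di Di; exists y.
pose E := [set y | exists2 i, D i & forall z, B i z -> y <= z].
have Eub j z : D j -> (forall w, B j w -> w <= z) -> ubound E z.
  move=> Dj zub e [i Di ei]; have [w [Biw Bjw]] := BB _ _ Di Dj.
  exact: le_trans (ei _ Biw) (zub _ Bjw).
exists (sup E) => i Di.
have [l Bl lmin] := compact_argmin (cB _ Di) (B0 _ Di) (idc _).
have [u Bu umax] := compact_argmax (cB _ Di) (B0 _ Di) (idc _).
have El : E l by exists i.
apply: (iB i l u) => //.
  by apply: ub_le_sup => //; exists u; exact: Eub umax.
by apply: ge_sup; [exists l | exact: Eub umax].
Qed.

Section ConvexConcave.
Variables (U1 U2 : set R) (f : R -> R -> R).
Hypotheses (U1_compact : compact U1) (U2_compact : compact U2).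
Hypotheses (U1_nonempty : U1 !=set0) (U2_nonempty : U2 !=set0).
Hypotheses (U1_conv : segment_closed U1) (U2_conv : segment_closed U2).
Hypothesis f_cont1 : forall y, U2 y -> {within U1, continuous (f ^~ y)}.
Hypothesis f_cont2 : forall r, U1 r -> {within U2, continuous (f r)}.
Hypothesis f_convex : forall y, U2 y -> convex_on U1 (f ^~ y).
Hypothesis f_concave : forall r, U1 r -> convex_on U2 (fun y => - f r y).

Section Optimal.
Variables a m : R.
Hypothesis Ua : U1 a.
Hypothesis a_guarantee : forall y, U2 y -> f a y <= m.
Hypothesis m_secured : forall r, U1 r -> exists2 y, U2 y & m <= f r y.

Let good r y := [/\ U2 y, m <= f a y & m <= f r y].

(** If no reply kept both [f a] and [f r] above [m], the smaller of the two
    would stay below [m] by a margin [d], by compactness. Convexity would then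
    push [f] below [m] for all replies at a control slightly moved from [a]
    towards [r], against the minimality of [m]. *)
Lemma optimal_reply r : U1 r -> exists y, good r y.
Proof.
move=> Ur; pose h y := Num.min (f a y) (f r y).
have ch : {within U2, continuous h}.
  by move=> x; apply: continuous_min; exact: f_cont2.
have [y0 Uy0 y0max] := compact_argmax U2_compact U2_nonempty ch.
have [mh|hm] := leP m (h y0).
  by exists y0; move: mh; rewrite /h le_min => /andP[].
have [y1 Uy1 y1max] := compact_argmax U2_compact U2_nonempty (f_cont2 Ur).
pose d := m - h y0; pose C := `|f r y1 - m|.
have d0 : 0 < d by rewrite subr_gt0.
have C0 : 0 <= C by exact: normr_ge0.
(* The step is so short that the gain of at most [C] at [r] cannot make up for
   the loss [d] at [a]. *)
pose t := d / (C + d + 1).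
have q0 : 0 < C + d + 1 by lra.
have t0 : 0 < t by rewrite divr_gt0.
have tE : t * (C + d + 1) = d by rewrite /t divfK// gt_eqF.
have t1 : t <= 1 by rewrite ler_pdivrMr//; lra.
have t01 : 0 <= t <= 1 by rewrite (ltW t0).
have [y Uy] := m_secured (U1_conv Ur Ua t01).
rewrite leNgt => /negP[]; apply: le_lt_trans (f_convex Uy Ur Ua t01) _.
have fam := a_guarantee Uy.
have [rm|mr] := ltP (f r y) m; first by nra.
have fry : f r y <= m + C.
  have := y1max _ Uy; have := ler_norm (f r y1 - m); rewrite -/C; lra.
have fay : f a y <= m - d.
  have := y0max _ Uy; rewrite {1}/h /d ge_min => /orP[|]; lra.
nra.
Qed.

(** If [r] lies between [a] and [r'], convexity and [f a y <= m] make a good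
    reply to [r] also good against [r']. *)
Lemma same_side_reply r r' t : U1 r -> U1 r' -> 0 <= t <= 1 ->
  r = t * a + (1 - t) * r' -> exists y, good r y /\ good r' y.
Proof.
move=> Ur Ur' t01 rE; have [ra|nra] := eqVneq r a.
  by have [y [? ? ?]] := optimal_reply Ur'; exists y; split; split; rewrite ?ra.
have [y [Uy may mry]] := optimal_reply Ur; exists y; split; split => //.
have := f_convex Uy Ua Ur' t01; rewrite -rE => frc.
have fam := a_guarantee Uy; have t1 : t < 1.
  rewrite lt_neqAle; case/andP: t01 => _ ->; rewrite andbT.
  by apply: contra nra => /eqP t1; rewrite rE t1; apply/eqP; ring.
move: t01 => /andP[t0 _]; nra.
Qed.

(** If [a] lies between [r] and [r'], convexity makes every best reply to [a]
    good against [r] or against [r']; the intermediate value theorem, applied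
    between a reply of each kind, gives one that is good against both. *)
Lemma opposite_side_reply r r' : U1 r -> U1 r' -> r <= a -> a <= r' ->
  exists y, good r y /\ good r' y.
Proof.
move=> Ur Ur' ra ar'; have [t t01 aE] := between_conv ra ar'.
have [y1 [U1y a1 r1]] := optimal_reply Ur.
have [y2 [U2y a2 r2]] := optimal_reply Ur'.
have cross y : U2 y -> m <= f a y -> m <= t * f r y + (1 - t) * f r' y.
  by move=> Uy may; apply: le_trans may _; rewrite {1}aE; exact: f_convex.
have [t0 t1] := andP t01.
(* It suffices to find a best reply to [a] at which [f r] and [f r'] agree. *)
have agree y : U2 y -> m <= f a y -> f r y - f r' y = 0 ->
    exists y, good r y /\ good r' y.
  move=> Uy may e; have := cross _ Uy may; exists y; split; split => //; nra.
have [r'1|r'1] := leP m (f r' y1); first by exists y1.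
have [r2'|r2'] := leP m (f r y2); first by exists y2.
have cont y y' : U2 y -> U2 y' ->
    {within `[y, y'], continuous (fun z => f r z - f r' z)}.
  move=> Uy Uy'; apply: (@continuous_subspaceW _ _ _ U2).
    by move=> z /=; rewrite in_itv/= => /andP[]; exact: segment_closed_between.
  by move=> z; apply: continuousB; exact: f_cont2.
have [y12|y21] := leP y1 y2.
  have [|z] := IVT (v := 0) y12 (cont _ _ U1y U2y).
    by rewrite ge_min le_max !subr_le0 !subr_ge0; apply/andP; split; apply/orP;
      [right|left]; lra.
  rewrite in_itv/= => /andP[yz zy]; apply: agree.
    exact: segment_closed_between U2_conv U1y U2y yz zy.
  exact: concave_between (f_concave Ua) U1y U2y yz zy a1 a2.
have [|z] := IVT (v := 0) (ltW y21) (cont _ _ U2y U1y).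
  by rewrite ge_min le_max !subr_le0 !subr_ge0; apply/andP; split; apply/orP;
    [left|right]; lra.
rewrite in_itv/= => /andP[yz zy]; apply: agree.
  exact: segment_closed_between U2_conv U2y U1y yz zy.
exact: concave_between (f_concave Ua) U2y U1y yz zy a2 a1.
Qed.

Lemma common_reply r r' : U1 r -> U1 r' -> exists y, good r y /\ good r' y.
Proof.
wlog rr' : r r' / r <= r'.
  move=> H Ur Ur'; have [/H|/ltW/H] := leP r r'; first exact.
  by move=> /(_ Ur' Ur)[y []]; exists y.
move=> Ur Ur'; have [ar|/ltW ra] := leP a r.
  by have [t t01 rE] := between_conv ar rr'; exact: (same_side_reply (t := t)).
have [ar'|/ltW r'a] := leP a r'; first exact: opposite_side_reply.
have [t /andP[t0 t1] r'E] := between_conv rr' r'a.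
have [||||y []] := @same_side_reply r' r (1 - t) => //; first by lra.
- by rewrite r'E; ring.
by exists y.
Qed.

(** The replies that are good against [a] and against a given [r] form a compact
    interval, and any two of these intervals meet; a common point is an optimal
    control of the second player. *)
Lemma optimal_saddle : exists b, saddle_point U1 U2 f a b.
Proof.
have [||||b bP] := @pairwise_common_point R U1
    (fun r => U2 `&` [set y | m <= Num.min (f a y) (f r y)]) => //.
- move=> r Ur; apply: compact_superlevel => // x.
  by apply: continuous_min; exact: f_cont2.
- move=> r x y z Ur [Ux xm] [Uy ym] xz zy.
  move: xm ym; rewrite /= !le_min => /andP[ax rx] /andP[ay ry].
  split; first exact: segment_closed_between U2_conv Ux Uy xz zy.
  apply/andP; split.
    exact: concave_between (f_concave Ua) Ux Uy xz zy ax ay.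
  exact: concave_between (f_concave Ur) Ux Uy xz zy rx ry.
- move=> r r' Ur Ur'; have [y [[Uy ay ry] [_ _ ry']]] := common_reply Ur Ur'.
  by exists y; split; split; rewrite //= le_min ay.
have {}bP r : U1 r -> [/\ U2 b, m <= f a b & m <= f r b].
  by move=> /bP[Ub]; rewrite /= le_min => /andP[].
have [Ub mab _] := bP _ Ua.
exists b; split=> // [y Uy|r Ur]; first exact: le_trans (a_guarantee Uy) mab.
by apply: le_trans (a_guarantee Ub) _; have [] := bP _ Ur.
Qed.

End Optimal.

Theorem convex_concave_saddle : exists a b, saddle_point U1 U2 f a b.
Proof.
have [a [m [Ua am mP]]] := minimax_strategy U1_compact U1_nonempty U2_compact
  U2_nonempty f_cont1 f_cont2.
by exists a; exact: optimal_saddle am mP.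
Qed.

End ConvexConcave.
End Minimax.

(** * The one-stage game *)

Section StageGame.
Context {R : realType} {S : finType}.
Implicit Types (U : set R) (V : S -> R).

Lemma convex_set_segment_closed U : convex_set (U : set R^o) -> segment_closed U.
Proof.
move=> cU x y t Ux Uy /andP[t0 t1].
by have := cU x y (Itv01 t0 t1); rewrite !inE => /(_ Ux Uy).
Qed.

Lemma convex_function_convex_on U (h : R -> R) :
  convex_function (U : set R^o) h -> convex_on U h.
Proof.
move=> ch x y t Ux Uy /andP[t0 t1].
by have := ch (Itv01 t0 t1) x y; rewrite !inE => /(_ Ux Uy).
Qed.

Section Sections.
Variables (U1 U2 : set R) (f : R -> R -> R).
Hypothesis f_cont : continuous_on_controls U1 U2 f.

Lemma continuous_section1 y : U2 y -> {within U1, continuous (f ^~ y)}.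
Proof.
move=> Uy; apply/subspace_continuousP => x Ux.
have /subspace_continuousP cf := f_cont.
apply: (@cvg_comp _ _ _ (fun r => (r, y)) (fun z => f z.1 z.2) _
  (within (U1 `*` U2) (nbhs (x, y)))); last exact: (cf (x, y) (conj Ux Uy)).
move=> A; rewrite /within/= => Axy.
have : (fun r : R => (r, y)) @ x --> (x, y).
  exact: (@cvg_pair _ _ _ _ _ _ _ _ _ id (cst y) cvg_id (cvg_cst y)).
move=> /(_ _ Axy) H; change (nbhs x [set r | U1 r -> A (r, y)]).
by refine (filterS (Filter := nbhs_filter x) _ H) => r /= Ar Ur; exact: Ar.
Qed.

Lemma continuous_section2 x : U1 x -> {within U2, continuous (f x)}.
Proof.
move=> Ux; apply/subspace_continuousP => y Uy.
have /subspace_continuousP cf := f_cont.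
apply: (@cvg_comp _ _ _ (fun r => (x, r)) (fun z => f z.1 z.2) _
  (within (U1 `*` U2) (nbhs (x, y)))); last exact: (cf (x, y) (conj Ux Uy)).
move=> A; rewrite /within/= => Axy.
have : (fun r : R => (x, r)) @ y --> (x, y).
  exact: (@cvg_pair _ _ _ _ _ _ _ _ _ (cst x) id (cvg_cst x) cvg_id).
move=> /(_ _ Axy) H; change (nbhs y [set r | U2 r -> A (x, r)]).
by refine (filterS (Filter := nbhs_filter y) _ H) => r /= Ar Ur; exact: Ar.
Qed.
End Sections.

(** An affine function on a compact interval interpolates between its values at
    the end points, with weights that do not depend on the function. *)
Lemma affine_interpolation U : compact U -> U !=set0 ->
  exists a b u v, [/\ U a, U b & forall h : R -> R,
    convex_on U h -> convex_on U (fun r => - h r) -> forall r, U r ->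
    h r = (u + v * r) * h a + (1 - (u + v * r)) * h b].
Proof.
move=> cU U0.
have idc : {within U, continuous (fun x : R => x)}.
  by apply: continuous_subspaceT => x; exact: cvg_id.
have [a Ua amin] := compact_argmin cU U0 idc.
have [b Ub bmax] := compact_argmax cU U0 idc.
have [ab|ab] := eqVneq a b.
  exists a, b, 0, 0; split=> // h _ _ r Ur.
  have -> : r = b by apply/eqP; rewrite eq_le bmax// -ab amin.
  by ring.
exists a, b, (b / (b - a)), (- (b - a)^-1); split=> // h ch chN r Ur.
set w := _ + _ * r.
have ba0 : b - a != 0 by rewrite subr_eq0 eq_sym.
have ba : 0 < b - a by rewrite lt_neqAle eq_sym ba0 subr_ge0 amin.
have wE : w = (b - r) / (b - a) by rewrite /w; field.
have rE : r = w * a + (1 - w) * b by rewrite wE; field.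
have w01 : 0 <= w <= 1.
  rewrite wE divr_ge0 ?subr_ge0 ?bmax ?(ltW ba)//= ler_pdivrMr// mul1r.
  by rewrite lerD2l lerN2 amin.
have := ch _ _ _ Ua Ub w01; have := chN _ _ _ Ua Ub w01.
rewrite -rE => h1 h2; apply/eqP; rewrite eq_le h2/=; move: h1; lra.
Qed.

Section Data.
Variables (U1 U2 : set R).
Variables (p : S -> S -> R -> R -> R) (c : S -> R -> R -> R).
Hypotheses (U1_compact : compact U1) (U1_nonempty : U1 !=set0).
Hypotheses (U2_compact : compact U2) (U2_nonempty : U2 !=set0).
Hypothesis p_transition : transition_probability U1 U2 p.
Hypothesis c_continuous : forall x, continuous_on_controls U1 U2 (c x).

Definition expected_next V x (r1 r2 : R) := \sum_y p x y r1 r2 * V y.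

Definition stage_cost V x (r1 r2 : R) := c x r1 r2 + expected_next V x r1 r2.

Lemma expected_next_continuous V x :
  (forall y, continuous_on_controls U1 U2 (p x y)) ->
  continuous_on_controls U1 U2 (expected_next V x).
Proof.
move=> cp r.
apply: (@cvg_big _ _ _ _ _ add_continuous) => y _.
by apply: cvgM; [exact: cp | exact: cvg_cst].
Qed.

Lemma stage_cost_continuous V x :
  (forall y, continuous_on_controls U1 U2 (p x y)) ->
  continuous_on_controls U1 U2 (stage_cost V x).
Proof.
move=> cp r; apply: cvgD; first exact: c_continuous.
exact: expected_next_continuous.
Qed.

Section Separable.
Hypothesis pc_separable : H1 U1 U2 p c.

(** The one-stage cost is a sum of a function of each control, which the players
    optimize independently. *)
Lemma separable_saddle V x : exists a b, saddle_point U1 U2 (stage_cost V x) a b.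
Proof.
case: pc_separable => pS cS.
have sep : separable U1 U2 (stage_cost V x).
  have [_ [c1 [c2 cE]]] := cS x.
  have [q1 /choice[q2 qE]] := choice (fun y => (pS x y).2).
  exists (fun r => c1 r + \sum_y q1 y r * V y),
         (fun r => c2 r + \sum_y q2 y r * V y) => r1 r2 Ur1 Ur2.
  rewrite /stage_cost /expected_next cE// addrACA -big_split/=; congr (_ + _).
  by apply: eq_bigr => y _; rewrite (qE y)// mulrDl.
have cont : continuous_on_controls U1 U2 (stage_cost V x).
  by apply: stage_cost_continuous => y; have [] := pS x y.
have [f1 [f2 fE]] := sep.
have [r1 Ur1] := U1_nonempty; have [r2 Ur2] := U2_nonempty.
have [a Ua amin] := compact_argmin U1_compact U1_nonempty
  (continuous_section1 cont Ur2).
have [b Ub bmax] := compact_argmax U2_compact U2_nonempty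
  (continuous_section2 cont Ur1).
exists a, b; split=> // [y Uy|r Ur].
  by have := bmax _ Uy; rewrite !fE// !lerD2l.
by have := amin _ Ur; rewrite !fE// !lerD2r.
Qed.

End Separable.

Section Convex.
Hypothesis pc_convex : H2 U1 U2 p c.

(** Up to a constant, the opposite of [q y] is the sum of the other members of
    the family. *)
Lemma oppr_convex_of_sum1 U (q : S -> R -> R) y : segment_closed U ->
  (forall r, U r -> \sum_z q z r = 1) -> (forall z, convex_on U (q z)) ->
  convex_on U (fun r => - q y r).
Proof.
move=> sU q1 cq r r' t Ur Ur' t01.
have qE s : U s -> - q y s = \sum_(z | z != y) q z s - 1.
  by move=> Us; have := q1 _ Us; rewrite (bigD1 y)//= => <-; ring.
rewrite !qE//; last exact: sU.
rewrite [leRHS](_ : _ = \sum_(z | z != y) (t * q z r + (1 - t) * q z r') - 1).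
  by rewrite lerD2r; apply: ler_sum => z _; exact: cq.
by rewrite big_split/= -!mulr_sumr; ring.
Qed.

(** Each transition probability is one minus the sum of the others, so it is
    concave as well as convex in each control. Being affine in each control, it
    is a polynomial on the rectangle of controls. *)
Lemma convex_p_continuous x y : continuous_on_controls U1 U2 (p x y).
Proof.
have [cp _] := pc_convex.
have [sU1 sU2 _ _] := cp x y.
have {}sU1 := convex_set_segment_closed sU1.
have {}sU2 := convex_set_segment_closed sU2.
have cp1 z r : U2 r -> convex_on U1 (fun s => p x z s r).
  by move=> Ur; have [_ _ + _] := cp x z; move=> /(_ _ Ur)/convex_function_convex_on.
have cp2 z r : U1 r -> convex_on U2 (fun s => - p x z r s).
  by move=> Ur; have [_ _ _] := cp x z; move=> /(_ _ Ur)/convex_function_convex_on.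
have cp1' z r : U2 r -> convex_on U1 (fun s => - p x z s r).
  move=> Ur; apply: (oppr_convex_of_sum1 (q := fun z s => p x z s r)) => //.
    by move=> s Us; have [] := p_transition x Us Ur.
  by move=> z'; exact: cp1.
have cp2' z r : U1 r -> convex_on U2 (p x z r).
  move=> Ur s s' t Us Us' t01.
  have [_ Es] := p_transition x Ur Us.
  have [_ Es'] := p_transition x Ur Us'.
  have [_ Et] := p_transition x Ur (sU2 _ _ _ Us Us' t01).
  have pE w : \sum_z p x z r w = 1 -> p x z r w = 1 - \sum_(i | i != z) p x i r w.
    by rewrite (bigD1 z)//= => <-; ring.
  rewrite !pE//.
  rewrite [leRHS](_ : _ = 1 - \sum_(i | i != z) (t * p x i r s + (1 - t) * p x i r s')).
    rewrite lerD2l lerN2; apply: ler_sum => i _.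
    by have := cp2 i _ Ur _ _ _ Us Us' t01; lra.
  by rewrite big_split/= -!mulr_sumr; ring.
have [a [b [u [v [Ua Ub i1]]]]] := affine_interpolation U1_compact U1_nonempty.
have [a' [b' [u' [v' [Ua' Ub' i2]]]]] := affine_interpolation U2_compact U2_nonempty.
pose q (r1 r2 : R) := (u + v * r1) * ((u' + v' * r2) * p x y a a' +
   (1 - (u' + v' * r2)) * p x y a b') + (1 - (u + v * r1)) *
   ((u' + v' * r2) * p x y b a' + (1 - (u' + v' * r2)) * p x y b b').
have pq r1 r2 : U1 r1 -> U2 r2 -> p x y r1 r2 = q r1 r2.
  move=> Ur1 Ur2; rewrite (i1 (fun s => p x y s r2))//; [|exact: cp1|exact: cp1'].
  by rewrite /q -!i2//; [exact: cp2'|exact: cp2|exact: cp2'|exact: cp2].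
rewrite /continuous_on_controls.
apply: (@subspace_eq_continuous _ _ _ (fun r => q r.1 r.2)).
  by move=> [r1 r2]; rewrite inE => -[/= Ur1 Ur2]; rewrite /from_subspace/= pq.
apply: continuous_subspaceT => r; rewrite /q.
have c1 : (fun r : R * R => u + v * r.1) @ r --> u + v * r.1.
  by apply: cvgD; [exact: cvg_cst|apply: cvgM; [exact: cvg_cst|exact: cvg_fst]].
have c2 : (fun r : R * R => u' + v' * r.2) @ r --> u' + v' * r.2.
  by apply: cvgD; [exact: cvg_cst|apply: cvgM; [exact: cvg_cst|exact: cvg_snd]].
by apply: cvgD; apply: cvgM => //; [|apply: cvgB => //; exact: cvg_cst|];
  apply: cvgD; apply: cvgM; try apply: cvgB; try exact: cvg_cst; exact: c2.
Qed.

Lemma convex_stage_saddle V x : (forall y, 0 <= V y) ->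
  exists a b, saddle_point U1 U2 (stage_cost V x) a b.
Proof.
move=> V0; have [cp cc] := pc_convex.
have [sU1 sU2 cc1 cc2] := cc x.
have cont : continuous_on_controls U1 U2 (stage_cost V x).
  by apply: stage_cost_continuous => y; exact: convex_p_continuous.
apply: convex_concave_saddle => //.
- exact: convex_set_segment_closed.
- exact: convex_set_segment_closed.
- exact: continuous_section1.
- exact: continuous_section2.
- move=> s Us r r' t Ur Ur' t01; rewrite /stage_cost /expected_next !mulrDr addrACA !mulr_sumr.
  apply: lerD; first by have /convex_function_convex_on := cc1 _ Us; exact.
  rewrite -big_split/=; apply: ler_sum => y _.
  have [_ _ + _] := cp x y => /(_ _ Us)/convex_function_convex_on.
  by move=> /(_ _ _ _ Ur Ur' t01) H; have := ler_wpM2r (V0 y) H; lra.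
- move=> s Us r r' t Ur Ur' t01; rewrite /stage_cost /expected_next.
  rewrite -lerN2 opprK opprD !mulrN !opprK.
  rewrite !mulrDr addrACA !mulr_sumr.
  apply: lerD.
    by have /convex_function_convex_on/(_ _ _ _ Ur Ur' t01) := cc2 _ Us; lra.
  rewrite -big_split/=; apply: ler_sum => y _.
  have [_ _ _] := cp x y => /(_ _ Us)/convex_function_convex_on.
  by move=> /(_ _ _ _ Ur Ur' t01) H; have := ler_wpM2r (V0 y) H; lra.
Qed.

End Convex.

Hypothesis H12 : H1 U1 U2 p c \/ H2 U1 U2 p c.

Lemma p_continuous x y : continuous_on_controls U1 U2 (p x y).
Proof. by case: H12 => [[/(_ x y)[]]|/convex_p_continuous]. Qed.

Lemma stage_saddle V x : (forall y, 0 <= V y) ->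
  exists a b, saddle_point U1 U2 (stage_cost V x) a b.
Proof.
by case: H12 => h V0; [exact: separable_saddle | exact: convex_stage_saddle].
Qed.

End Data.
End StageGame.

(** * Measurability and one step of an admissible chain *)

Section MeasurableControls.
Context {R : realType} d (T : measurableType d).
Variables (U1 U2 : set R) (f : R -> R -> R) (X Y : T -> R).
Hypothesis f_cont : continuous_on_controls U1 U2 f.
Hypotheses (mX : measurable_fun setT X) (mY : measurable_fun setT Y).
Hypothesis XY : forall w, U1 (X w) /\ U2 (Y w).

(** By continuity each superlevel set of [f] in the controls is the union of the
    traces of rational boxes that it contains. *)
Lemma measurable_fun_controls : measurable_fun setT (fun w => f (X w) (Y w)).
Proof.
move=> mT; apply: (measurability _ (RGenOInfty.measurableE R)) => // _ [_ [a ->] <-].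
pose box (q : rat * rat * rat * rat) : set (R * R) :=
  [set r | ratr q.1.1.1 < r.1 < ratr q.1.1.2 /\ ratr q.1.2 < r.2 < ratr q.2].
pose inside q := `[< forall r, U1 r.1 -> U2 r.2 -> box q r -> a < f r.1 r.2 >].
rewrite (_ : _ `&` _ =
    \bigcup_q if inside q then [set w | box q (X w, Y w)] else set0).
  apply: countable_bigcupT_measurable => [|q]; first exact: countableP.
  case: ifPn => // _.
  rewrite (_ : mkset _ = (X @^-1` `]ratr q.1.1.1, ratr q.1.1.2[) `&`
                         (Y @^-1` `]ratr q.1.2, ratr q.2[)).
    by apply: measurableI; rewrite -[_ @^-1` _]setTI; [apply: mX|apply: mY].
  by apply/seteqP; split=> w /=; rewrite !in_itv.
apply/seteqP; split=> w /=; last first.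
  move=> [q _]; case: ifPn => // /asboolP qa bq; have [Ux Uy] := XY w.
  by rewrite in_itv/= andbT; split=> //; exact: (qa (X w, Y w)).
rewrite in_itv/= andbT => -[_ aw]; have [Ux Uy] := XY w.
have /subspace_continuousP cf := f_cont.
have e0 : 0 < f (X w) (Y w) - a by rewrite subr_gt0.
have /cvgrPdist_lt/(_ _ e0) := cf (X w, Y w) (conj Ux Uy).
rewrite near_withinE => /nbhs_ballP[e/= e1 ball_f].
have /rat_in_itvoo[q1 /itvP q1P] : X w - e < X w by rewrite gtrBl.
have /rat_in_itvoo[q2 /itvP q2P] : X w < X w + e by rewrite ltrDl.
have /rat_in_itvoo[q3 /itvP q3P] : Y w - e < Y w by rewrite gtrBl.
have /rat_in_itvoo[q4 /itvP q4P] : Y w < Y w + e by rewrite ltrDl.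
exists (q1, q2, q3, q4) => //; rewrite ifT.
  by rewrite /box/= q1P q2P q3P q4P.
apply/asboolP => -[x y]/= Ux' Uy' [/andP[qx xq] /andP[qy yq]].
have /ball_f/(_ (conj Ux' Uy')) : ball (X w, Y w) e (x, y).
  have := (q1P, q2P, q3P, q4P) => q.
  split; rewrite /ball/= ltr_distlC.
    by rewrite (lt_trans _ qx) ?(lt_trans xq) ?q.
  by rewrite (lt_trans _ qy) ?(lt_trans yq) ?q.
rewrite /= /from_subspace/= => /ltr_normlP[_]; lra.
Qed.

End MeasurableControls.

Section FiniteValued.
Context {R : realType} {S : finType} d (T : measurableType d).
Variables (X : T -> S).
Hypothesis mX : forall s, measurable (X @^-1` [set s]).

Lemma measurable_finite_preimage (B : set S) : measurable (X @^-1` B).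
Proof.
rewrite (_ : _ @^-1` _ = \bigcup_(s in B) (X @^-1` [set s])).
  by apply: fin_bigcup_measurable => //; exact: finite_finset.
by apply/seteqP; split=> w /= => [Bw|[s Bs /= ->//]]; exists (X w).
Qed.

Lemma measurable_finite_choice (h : S -> T -> R) :
  (forall s, measurable_fun setT (h s)) ->
  measurable_fun setT (fun w => h (X w) w).
Proof.
move=> mh; rewrite (_ : (fun w => _) =
    (fun w => \sum_s \1_(X @^-1` [set s]) w * h s w)).
  by apply: measurable_sum => s; apply: measurable_funM.
apply/funext => w; rewrite (bigD1 (X w))//= indicE mem_set// mul1r big1 ?addr0//.
by move=> s sX; rewrite indicE memNset ?mul0r// => /= Xs; rewrite Xs eqxx in sX.
Qed.

Lemma integral_finite_valued (P : {measure set T -> \bar R}) (A : set T)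
    (V : S -> R) : measurable A -> (forall s, 0 <= V s) ->
  (\int[P]_(w in A) (V (X w))%:E =
   \sum_s (V s)%:E * P (A `&` X @^-1` [set s]))%E.
Proof.
move=> mA V0.
rewrite (eq_integral (fun w => \sum_s (V s)%:E * (\1_(X @^-1` [set s]) w)%:E)%E).
  rewrite ge0_integral_sum//.
  - apply: eq_bigr => s _; rewrite ge0_integralZl_EFin//.
    + by rewrite integral_indic// setIC.
    + by apply/measurable_EFinP; apply: measurable_indic; exact: mX.
  - by move=> s; apply/measurable_EFinP; apply: measurable_funM.
  - by move=> s w _; rewrite -EFinM lee_fin mulr_ge0.
move=> w _; rewrite (bigD1 (X w))//= indicE mem_set// mule1 big1 ?adde0//.
move=> s sX; rewrite indicE memNset ?mule0// => /= Xs; rewrite Xs eqxx in sX.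
by [].
Qed.

End FiniteValued.

Section AdmissibleChain.
Context {R : realType} {S : finType}.
Variables (U1 U2 : set R) (p : S -> S -> R -> R -> R).
Hypothesis p_transition : transition_probability U1 U2 p.
Hypothesis p_cont : forall x y, continuous_on_controls U1 U2 (p x y).
Context d (T : measurableType d) (P : probability T R).
Variables (xi : nat -> T -> S) (u1 u2 : nat -> T -> R).
Hypothesis adm : admissible U1 U2 p P xi u1 u2.

Lemma measurable_state n s : measurable (xi n @^-1` [set s]).
Proof. by have [+ _ _ _] := adm; exact. Qed.

Lemma controls_in n w : U1 (u1 n w) /\ U2 (u2 n w).
Proof. by have [_ _ + _] := adm; exact. Qed.

Lemma measurable_state_controls (f : S -> R -> R -> R) n :
  (forall x, continuous_on_controls U1 U2 (f x)) ->
  measurable_fun setT (fun w => f (xi n w) (u1 n w) (u2 n w)).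
Proof.
move=> cf; apply: (measurable_finite_choice (measurable_state n)
  (h := fun s w => f s (u1 n w) (u2 n w))) => s.
have [_ /(_ n)[m1 m2] _ _] := adm.
by apply: (measurable_fun_controls (cf s)) => // w; exact: controls_in.
Qed.

Lemma measurable_state_fun (V : S -> R) n : measurable_fun setT (V \o xi n).
Proof.
apply: (measurable_finite_choice (measurable_state n) (h := fun s _ => V s)) => s.
exact: measurable_cst.
Qed.

Lemma history_measurable n A : <<s history_events xi u1 u2 n >> A -> measurable A.
Proof.
apply: smallest_sub; first exact: sigma_algebra_measurable.
have [mxi mu _ _] := adm.
move=> _ [k _ [[s ->]|[B mB ->]|[B mB ->]]]; first exact: mxi.
  by rewrite -[_ @^-1` _]setTI; apply: (mu k).1.
by rewrite -[_ @^-1` _]setTI; apply: (mu k).2.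
Qed.

Lemma expected_next_ge0 V n w : (forall y, 0 <= V y) ->
  0 <= expected_next p V (xi n w) (u1 n w) (u2 n w).
Proof.
move=> V0; have [Ua Ub] := controls_in n w.
by have [p0 _] := p_transition (xi n w) Ua Ub; apply: sumr_ge0 => y _; rewrite mulr_ge0.
Qed.

Lemma measurable_expected_next V n :
  measurable_fun setT (fun w => expected_next p V (xi n w) (u1 n w) (u2 n w)).
Proof.
apply: measurable_state_controls => x; exact: expected_next_continuous.
Qed.

Lemma history_setT n : <<s history_events xi u1 u2 n >> setT.
Proof.
have [/= S0 SC _] := smallest_sigma_algebra setT (history_events xi u1 u2 n).
by have := SC _ S0; rewrite setD0.
Qed.

(** The Markov property: admissibility, extended by linearity from indicators
    of single states to functions of the next state. *)
Lemma integral_next (V : S -> R) n A : (forall y, 0 <= V y) ->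
  <<s history_events xi u1 u2 n >> A ->
  (\int[P]_(w in A) (V (xi n.+1 w))%:E =
   \int[P]_(w in A) (expected_next p V (xi n w) (u1 n w) (u2 n w))%:E)%E.
Proof.
move=> V0 hA; have mA := history_measurable hA.
rewrite (integral_finite_valued (measurable_state _))//.
have p0 y w : 0 <= p (xi n w) y (u1 n w) (u2 n w).
  by have [Ua Ub] := controls_in n w; have [] := p_transition (xi n w) Ua Ub.
have mp y : measurable_fun A (fun w => (p (xi n w) y (u1 n w) (u2 n w))%:E).
  apply/measurable_EFinP/measurable_funTS.
  exact: (measurable_state_controls (f := fun x => p x y)).
under [RHS]eq_integral do rewrite /expected_next -sumEFin.
rewrite ge0_integral_sum//; last first.
- by move=> y w _; rewrite lee_fin mulr_ge0.
- move=> y; under eq_fun do rewrite EFinM.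
  by apply: emeasurable_funM.
apply: eq_bigr => y _; have [_ _ _ hp] := adm.
transitivity ((V y)%:E * \int[P]_(w in A)
    (p (xi n w) y (u1 n w) (u2 n w))%:E)%E.
  by congr (_ * _)%E; exact: hp.
rewrite -ge0_integralZl_EFin//.
- by apply: eq_integral => w _; rewrite -EFinM mulrC.
- by move=> w _; rewrite lee_fin.
Qed.

End AdmissibleChain.

(** * Comparing the expected total cost with a solution of the Isaacs equation *)

Section PathCost.
Context {R : realType} {S : finType} (dS : {set S}).
Variables (c : S -> R -> R -> R) (g : S -> R).
Implicit Types (x : nat -> S) (r : nat -> R).

Definition alive k x := [forall j : 'I_k, x j \notin dS].

Lemma alive0 x : alive 0 x.
Proof. by apply/forallP => -[]. Qed.

Lemma aliveS k x : alive k.+1 x = alive k x && (x k \notin dS).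
Proof.
apply/forallP/andP => [H|[/forallP H xk] j].
  by split; [apply/forallP => j; exact: (H (widen_ord (leqnSn k) j)) | exact: (H ord_max)].
have [jk|kj] := ltnP j k; first exact: (H (Ordinal jk)).
by have -> : val j = k by apply/eqP; rewrite eqn_leq kj -ltnS ltn_ord.
Qed.

(** The cost incurred exactly at time [k], where the terminal cost is charged on
    entering [dS]. This turns the total cost into one series, whether or not
    [dS] is ever reached. *)
Definition cost_at x r1 r2 k : R :=
  if alive k x then if x k \in dS then g (x k) else c (x k) (r1 k) (r2 k) else 0.

Lemma total_cost_series x r1 r2 :
  total_cost dS c g x r1 r2 = (\sum_(0 <= k <oo) (cost_at x r1 r2 k)%:E)%E.
Proof.
rewrite /total_cost; case: pselect => [hit|nhit]; last first.
  have out k : x k \notin dS by apply/negP => xk; apply: nhit; exists k.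
  apply: eq_eseriesr => k _; rewrite /cost_at (negbTE (out k)) ifT//.
  by apply/forallP => j; exact: out.
case: ex_minnP => N xN Nmin.
have before k : (k < N)%N -> x k \notin dS.
  by move=> kN; apply/negP => /Nmin; rewrite leqNgt kN.
have aliveN k : (k <= N)%N -> alive k x.
  by move=> kN; apply/forallP => j; apply: before; exact: leq_trans (ltn_ord j) kN.
symmetry; apply: lim_near_cst => //.
exists N.+1 => // m /= Nm; rewrite (big_cat_nat (n := N.+1))//= [X in (_ + X)%E]big1_seq.
  rewrite adde0 big_nat_recr//= /cost_at aliveN// xN EFinD -sumEFin big_mkord.
  congr (_ + _)%E; apply: eq_bigr => k _.
  by rewrite aliveN 1?ltnW// (negbTE (before _ _)).
move=> k /andP[_]; rewrite mem_index_iota => /andP[Nk _].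
rewrite /cost_at ifF//; apply/negbTE/negP => /forallP/(_ (Ordinal Nk))/=.
by rewrite xN.
Qed.

End PathCost.

Section Verification.
Context {R : realType} {S : finType} (dS : {set S}).
Variables (U1 U2 : set R) (p : S -> S -> R -> R -> R).
Variables (c : S -> R -> R -> R) (g : S -> R).
Hypothesis p_transition : transition_probability U1 U2 p.
Hypothesis p_cont : forall x y, continuous_on_controls U1 U2 (p x y).
Hypothesis c_ge0 : forall x r1 r2, U1 r1 -> U2 r2 -> 0 <= c x r1 r2.
Hypothesis c_cont : forall x, continuous_on_controls U1 U2 (c x).
Hypothesis g_ge0 : forall x, 0 <= g x.
Context d (T : measurableType d) (P : probability T R).
Variables (xi : nat -> T -> S) (u1 u2 : nat -> T -> R) (x : S).
Hypothesis adm : admissible U1 U2 p P xi u1 u2.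
Hypothesis xi0 : forall w, xi 0%N w = x.

Let running k w := alive dS k (xi ^~ w).

Lemma history_alive k :
  <<s history_events xi u1 u2 k >> [set w | running k.+1 w].
Proof.
pose M := g_sigma_algebraType (history_events xi u1 u2 k).
have mxi (j : 'I_k.+1) (s : S) : @measurable _ M (xi j @^-1` [set s]).
  apply: sub_sigma_algebra; exists (val j); first by rewrite -ltnS ltn_ord.
  by apply: Or31; exists s.
change (@measurable _ M [set w | running k.+1 w]).
rewrite (_ : mkset _ = \bigcap_(j in [set: 'I_k.+1]) (xi j @^-1` [set s | s \notin dS])).
  apply: fin_bigcap_measurable => // j _; exact: measurable_finite_preimage (mxi j) _.
apply/seteqP; split=> w /= => [/forallP H j _|H]; first exact: H.
by apply/forallP => j; exact: H.
Qed.

Lemma measurable_running k : measurable_fun setT (running k).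
Proof.
apply: (measurable_fun_bool true); rewrite setTI; case: k => [|k].
  rewrite (_ : _ @^-1` _ = setT)//; apply/seteqP; split=> // w _.
  exact: alive0.
exact: (history_measurable adm (@history_alive k)).
Qed.

Lemma measurable_if_running k (h : T -> R) : measurable_fun setT h ->
  measurable_fun setT (fun w => if running k w then h w else 0).
Proof. by move=> mh; apply: measurable_fun_ifT => //; exact: measurable_running. Qed.

Let cost_now k w := if xi k w \in dS then g (xi k w) else c (xi k w) (u1 k w) (u2 k w).

Lemma measurable_cost_now k : measurable_fun setT (cost_now k).
Proof.
apply: measurable_fun_ifT.
- apply: (measurable_fun_bool true); rewrite setTI.
  exact: (measurable_finite_preimage (measurable_state adm k) [set s | s \in dS]).
- exact: (measurable_state_fun adm).
- exact: (measurable_state_controls adm).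
Qed.

Lemma cost_now_ge0 k w : 0 <= cost_now k w.
Proof.
rewrite /cost_now; case: ifP => // _.
by have [Ua Ub] := controls_in adm k w; exact: c_ge0.
Qed.

Let cost k w := cost_at dS c g (xi ^~ w) (u1 ^~ w) (u2 ^~ w) k.

Lemma measurable_cost k : measurable_fun setT (cost k).
Proof. exact: (measurable_if_running k (measurable_cost_now k)). Qed.

Lemma cost_ge0 k w : 0 <= cost k w.
Proof. by rewrite /cost /cost_at; case: ifP => // _; exact: cost_now_ge0. Qed.

Lemma integral_total_cost :
  (\int[P]_w total_cost dS c g (xi ^~ w) (u1 ^~ w) (u2 ^~ w) =
   \sum_(0 <= k <oo) \int[P]_w (cost k w)%:E)%E.
Proof.
under eq_integral do rewrite total_cost_series.
rewrite integral_nneseries//.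
- by move=> k; apply/measurable_EFinP; exact: measurable_cost.
- by move=> k w _; rewrite lee_fin cost_ge0.
Qed.

Section Value.
Variable V : S -> R.
Hypothesis V_ge0 : forall y, 0 <= V y.

Definition remaining k := (\int[P]_w (if running k w then V (xi k w) else 0)%:E)%E.

Lemma remaining0 : remaining 0 = (V x)%:E.
Proof.
rewrite /remaining (eq_integral (cst (V x)%:E)).
  by rewrite integral_cst// -[RHS]mule1; congr (_ * _)%E; exact: probability_setT.
by move=> w _; rewrite /running alive0 xi0.
Qed.

Lemma remaining_ge0 k : (0 <= remaining k)%E.
Proof. by apply: integral_ge0 => w _; rewrite lee_fin; case: ifP. Qed.

Let payment k w := if running k w then
  if xi k w \in dS then g (xi k w) else stage_cost p c V (xi k w) (u1 k w) (u2 k w)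
  else 0.

(** One step of the dynamic programming recursion: the event of not having been
    absorbed up to time [k] belongs to the history, so the payment due at time
    [k.+1] can be replaced by its conditional expectation. *)
Lemma remaining_next k :
  (\int[P]_w (cost k w)%:E + remaining k.+1 = \int[P]_w (payment k w)%:E)%E.
Proof.
pose next w := expected_next p V (xi k w) (u1 k w) (u2 k w).
have mnext : measurable_fun setT next by exact: (measurable_expected_next p_cont adm).
have next0 w : 0 <= next w by exact: (expected_next_ge0 p_transition adm).
have -> : remaining k.+1 =
    (\int[P]_w (if running k.+1 w then next w else 0)%:E)%E.
  have hA := @history_alive k.
  have mem w : (w \in [set w | running k.+1 w]) = running k.+1 w.
    by apply/idP/idP; rewrite inE.
  transitivity (\int[P]_(w in [set w | running k.+1 w]) (V (xi k.+1 w))%:E)%E.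
    rewrite integral_mkcond; apply: eq_integral => w _; rewrite patchE mem.
    by case: (running _ _).
  rewrite (integral_next p_transition p_cont adm)// integral_mkcond.
  by apply: eq_integral => w _; rewrite patchE mem; case: (running _ _).
rewrite -ge0_integralD//.
- apply: eq_integral => w _; rewrite -EFinD; congr (_%:E).
  rewrite /cost /cost_at /payment /running aliveS.
  case: (alive _ _ _) => /=; last by rewrite addr0.
  by case: ifP => _ /=; rewrite ?addr0.
- by move=> w _; rewrite lee_fin cost_ge0.
- by apply/measurable_EFinP; exact: measurable_cost.
- by move=> w _; rewrite lee_fin; case: ifP.
- by apply/measurable_EFinP; exact: measurable_if_running.
Qed.

Hypothesis V_boundary : forall y, y \in dS -> V y = g y.

Let measurable_value k :
  measurable_fun setT (fun w => (if running k w then V (xi k w) else 0)%:E).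
Proof.
apply/measurable_EFinP; apply: measurable_if_running.
exact: (measurable_state_fun adm).
Qed.

Let measurable_payment k : measurable_fun setT (fun w => (payment k w)%:E).
Proof.
apply/measurable_EFinP; apply: measurable_if_running.
apply: measurable_fun_ifT.
- apply: (measurable_fun_bool true); rewrite setTI.
  exact: (measurable_finite_preimage (measurable_state adm k) [set s | s \in dS]).
- exact: (measurable_state_fun adm).
- apply: (measurable_state_controls adm) => y; exact: stage_cost_continuous.
Qed.

Lemma stage_cost_ge0 k w : 0 <= stage_cost p c V (xi k w) (u1 k w) (u2 k w).
Proof.
have [Ua Ub] := controls_in adm k w.
by apply: addr_ge0; [exact: c_ge0 | exact: (expected_next_ge0 p_transition adm)].
Qed.

Let payment_ge0 k w : 0 <= payment k w.
Proof.
by rewrite /payment; case: ifP => // _; case: ifP => // _; exact: stage_cost_ge0.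
Qed.

(** If the controls in use make [V] a supersolution along the chain, paying the
    costs step by step and then [V] never increases the expected total. *)
Lemma total_cost_le :
  (forall k w, xi k w \notin dS ->
     stage_cost p c V (xi k w) (u1 k w) (u2 k w) <= V (xi k w)) ->
  (\int[P]_w total_cost dS c g (xi ^~ w) (u1 ^~ w) (u2 ^~ w) <= (V x)%:E)%E.
Proof.
move=> superV.
have step k : (\int[P]_w (cost k w)%:E + remaining k.+1 <= remaining k)%E.
  rewrite remaining_next; apply: ge0_le_integral => //.
  - by move=> w _; rewrite lee_fin.
  - move=> w _; rewrite lee_fin /payment; case: ifP => // _.
    by case: ifPn => [/V_boundary->//|/superV].
have sums m : (\sum_(0 <= k < m) \int[P]_w (cost k w)%:E + remaining m <= (V x)%:E)%E.
  elim: m => [|m IH]; first by rewrite big_nil add0e remaining0.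
  by rewrite big_nat_recr//= -addeA; apply: le_trans IH; exact: leeD2l.
rewrite integral_total_cost; apply: lime_le.
  by apply: is_cvg_nneseries => k _ _; apply: integral_ge0 => w _; rewrite lee_fin cost_ge0.
by apply: nearW => m; apply: le_trans (sums m); rewrite leeDl// remaining_ge0.
Qed.

Section Absorption.
Variables (phi : S -> R) (rho : R).
Hypothesis phi_ge0 : forall y, 0 <= phi y.
Hypothesis phi_ge1 : forall y, y \notin dS -> 1 <= phi y.
Hypothesis rho01 : 0 <= rho < 1.
Hypothesis phi_contract : forall y r1 r2, U1 r1 -> U2 r2 ->
  expected_next p phi y r1 r2 <= rho * phi y.

Lemma expected_phi m : (\int[P]_w (phi (xi m w))%:E <= (rho ^+ m * phi x)%:E)%E.
Proof.
elim: m => [|m IH].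
  rewrite (eq_integral (cst (phi x)%:E)); last by move=> w _; rewrite xi0.
  rewrite integral_cst// expr0 mul1r -[leRHS]mule1 le_eqVlt; apply/orP; left.
  by apply/eqP; congr (_ * _)%E; exact: probability_setT.
have rho0 : 0 <= rho by case/andP: rho01.
rewrite (integral_next p_transition p_cont adm)//; last exact: history_setT.
apply: (@le_trans _ _ (\int[P]_w (rho%:E * (phi (xi m w))%:E))%E).
  apply: ge0_le_integral => //.
  - by move=> w _; rewrite lee_fin (expected_next_ge0 p_transition adm).
  - by apply/measurable_EFinP; exact: (measurable_expected_next p_cont adm).
  - apply/measurable_EFinP; apply: measurable_funM => //.
    exact: (measurable_state_fun adm).
  - move=> w _; rewrite -EFinM lee_fin.
    by have [Ua Ub] := controls_in adm m w; exact: phi_contract.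
rewrite ge0_integralZl_EFin//.
- by rewrite exprS -mulrA EFinM; apply: lee_wpmul2l; rewrite ?lee_fin.
- by move=> w _; rewrite lee_fin.
- by apply/measurable_EFinP; exact: (measurable_state_fun adm).
Qed.

Lemma remaining_small : exists C, forall m, (remaining m.+1 <= (C * rho ^+ m)%:E)%E.
Proof.
pose M := \sum_y V y.
have VM y : V y <= M.
  by rewrite /M (bigD1 y)//= lerDl; apply: sumr_ge0.
have M0 : 0 <= M by apply: sumr_ge0.
exists (M * phi x) => m.
apply: (@le_trans _ _ (\int[P]_w (M%:E * (phi (xi m w))%:E))%E).
  apply: ge0_le_integral => //.
  - by move=> w _; rewrite lee_fin; case: ifP.
  - apply/measurable_EFinP; apply: measurable_funM => //.
    exact: (measurable_state_fun adm).
  - move=> w _; rewrite -EFinM lee_fin /running aliveS; case: ifP => [/andP[_ out]|_].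
      by apply: le_trans (VM _) _; rewrite ler_peMr// phi_ge1.
    by rewrite mulr_ge0.
rewrite ge0_integralZl_EFin//.
- rewrite -mulrA [_ * rho ^+ m]mulrC EFinM; apply: lee_wpmul2l; first by rewrite lee_fin.
  exact: expected_phi.
- by move=> w _; rewrite lee_fin.
- by apply/measurable_EFinP; exact: (measurable_state_fun adm).
Qed.

(** For a subsolution the expected total never decreases, and the payment that
    remains due vanishes in the limit because the chain is absorbed. *)
Lemma total_cost_ge :
  (forall k w, xi k w \notin dS ->
     V (xi k w) <= stage_cost p c V (xi k w) (u1 k w) (u2 k w)) ->
  ((V x)%:E <= \int[P]_w total_cost dS c g (xi ^~ w) (u1 ^~ w) (u2 ^~ w))%E.
Proof.
move=> subV.
have step k : (remaining k <= \int[P]_w (cost k w)%:E + remaining k.+1)%E.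
  rewrite remaining_next; apply: ge0_le_integral => //.
  - by move=> w _; rewrite lee_fin; case: ifP.
  - move=> w _; rewrite lee_fin /payment; case: ifP => // _.
    by case: ifPn => [/V_boundary->//|/subV].
have sums m : ((V x)%:E <= \sum_(0 <= k < m) \int[P]_w (cost k w)%:E + remaining m)%E.
  elim: m => [|m IH]; first by rewrite big_nil add0e remaining0.
  by rewrite big_nat_recr//= -addeA; apply: le_trans IH _; exact: leeD2l.
have [C HC] := remaining_small.
apply/lee_addgt0Pr => e e0.
have rho1 : `|rho| < 1 by have /andP[r0 r1] := rho01; rewrite ger0_norm.
have /cvgrPdist_lt/(_ e e0)[m _ /(_ m (leqnn m))] := @cvg_geometric R C _ rho1.
rewrite /= sub0r normrN => /(le_lt_trans (ler_norm _))/ltW Cm.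
apply: le_trans (sums m.+1) _; apply: leeD.
  rewrite integral_total_cost; apply: nneseries_lim_ge => k _ _.
  by apply: integral_ge0 => w _; rewrite lee_fin cost_ge0.
by apply: le_trans (HC m) _; rewrite lee_fin.
Qed.

End Absorption.
End Value.
End Verification.

(** * Existence of a controlled chain *)

Section UnitInterval.
Context {R : realType}.

Definition uniform01 := mrestr (@lebesgue_measure R) (measurable_itv `[0 : R, 1[).

HB.instance Definition _ := Measure.on uniform01.

Let uniform01_setT : uniform01 setT = 1%:E.
Proof.
by rewrite /uniform01 /mrestr setTI lebesgue_measure_itv/= lte_fin ltr01 sube0.
Qed.

HB.instance Definition _ := Measure_isProbability.Build _ _ _ uniform01 uniform01_setT.

End UnitInterval.

Section ChainExistence.
Context {R : realType} {S : finType}.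
Variables (U1 U2 : set R) (p : S -> S -> R -> R -> R).
Hypothesis p_transition : transition_probability U1 U2 p.
Context d (T : measurableType d) (P : probability T R) (unif : T -> R).
Hypothesis measurable_unif : measurable_fun setT unif.
Hypothesis unif01 : forall t, 0 <= unif t < 1.
Hypothesis unif_law : forall a b, 0 <= a -> a <= b -> b <= 1 ->
  P (unif @^-1` `[a, b[%classic) = (b - a)%:E.
Variables (x : S) (a1 a2 : nat -> (nat -> S) -> R).
Hypothesis a1_in : forall n X, U1 (a1 n X).
Hypothesis a2_in : forall n X, U2 (a2 n X).

Definition nonanticipating (a : nat -> (nat -> S) -> R) :=
  forall n X Y, (forall k, (k <= n)%N -> X k = Y k) -> a n X = a n Y.

Hypothesis a1_past : nonanticipating a1.
Hypothesis a2_past : nonanticipating a2.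
Implicit Types (w : seq S) (y z : S) (r : R) (t : T).

(** Words list the states visited after [x], the most recent one first, so that
    extending a trajectory is consing. *)
Let trajectory w k := nth x (x :: rev w) k.

Let q w y := p (head x w) y (a1 (size w) (trajectory w)) (a2 (size w) (trajectory w)).

Let q_ge0 w y : 0 <= q w y.
Proof. by have [+ _] := p_transition (head x w)
  (a1_in (size w) (trajectory w)) (a2_in (size w) (trajectory w)); exact. Qed.

Let q_sum w : \sum_y q w y = 1.
Proof. by have [_ +] := p_transition (head x w)
  (a1_in (size w) (trajectory w)) (a2_in (size w) (trajectory w)); exact. Qed.

Let before w y := \sum_(z | (enum_rank z < enum_rank y)%N) q w z.

Let before_split w y :
  before w y + q w y = \sum_(z | (enum_rank z <= enum_rank y)%N) q w z.
Proof.
rewrite [RHS](bigD1 y)//= addrC; congr (_ + _); apply: eq_bigl => z.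
by rewrite ltn_neqAle andbC (inj_eq val_inj) (inj_eq enum_rank_inj).
Qed.

Let sum_subset w (A B : pred S) : (forall z, A z -> B z) ->
  \sum_(z | A z) q w z <= \sum_(z | B z) q w z.
Proof.
move=> AB; rewrite [leLHS]big_mkcond [leRHS]big_mkcond; apply: ler_sum => z _.
by case: ifP => [/AB ->//|_]; case: ifP.
Qed.

Let before_next w y z : (enum_rank y < enum_rank z)%N -> before w y + q w y <= before w z.
Proof.
by move=> yz; rewrite before_split; apply: sum_subset => s sy; exact: leq_ltn_trans yz.
Qed.

Let before_ge0 w y : 0 <= before w y.
Proof. exact: sumr_ge0. Qed.

Let before_le1 w y : before w y + q w y <= 1.
Proof. by rewrite before_split -(q_sum w); exact: sum_subset. Qed.

Let before_cover w r : 0 <= r -> r < 1 ->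
  exists y, before w y <= r < before w y + q w y.
Proof.
move=> r0 r1; have S0 : (0 < #|S|)%N by apply/card_gt0P; exists x.
have lastS : (#|S|.-1 < #|S|)%N by rewrite ltn_predL.
pose last := enum_val (Ordinal lastS).
have r_last : r < before w last + q w last.
  rewrite before_split (eq_bigl xpredT) ?q_sum// => s.
  by rewrite /last enum_valK /= -ltnS prednK// ltn_ord.
have [y ry ymin] := @arg_minnP _ last (fun y => r < before w y + q w y)
  (fun y => enum_rank y) r_last.
exists y; rewrite ry andbT leNgt; apply/negP => rb.
have [y0|ypos] := posnP (enum_rank y : nat).
  by move: rb; rewrite /before big_pred0 ?ltNge ?r0// => z; rewrite y0.
have prevS : ((enum_rank y).-1 < #|S|)%N.
  by rewrite (leq_ltn_trans (leq_pred _))// ltn_ord.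
pose z := enum_val (Ordinal prevS).
have zE : enum_rank z = (enum_rank y).-1 :> nat by rewrite /z enum_valK.
have rz : r < before w z + q w z.
  rewrite before_split zE (eq_bigl (fun s => (enum_rank s < enum_rank y)%N))// => s.
  by rewrite -ltnS prednK.
by have := ymin _ rz; rewrite zE -ltnS prednK// ltnn.
Qed.

(** One uniform variable draws the whole trajectory. Each word gets a cell, a
    subinterval of the unit interval whose length is the probability of the
    word; the cells of its one-step extensions partition it. *)
Fixpoint len w : R := if w is y :: w' then len w' * q w' y else 1.
Fixpoint lo w : R := if w is y :: w' then lo w' + len w' * before w' y else 0.

Let cell w r := lo w <= r < lo w + len w.

Let len_ge0 w : 0 <= len w.
Proof. by elim: w => //= y w IH; rewrite mulr_ge0. Qed.

Let cell_sub y w r : cell (y :: w) r -> cell w r.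
Proof.
rewrite /cell/= => /andP[lr1 lr2]; apply/andP; split.
  by apply: le_trans lr1; rewrite lerDl mulr_ge0.
apply: lt_le_trans lr2 _; rewrite -addrA -mulrDr lerD2l.
by rewrite ler_piMr.
Qed.

Let cell_split w r : cell w r -> exists y, cell (y :: w) r.
Proof.
rewrite /cell => /andP[lr1 lr2].
have l0 : 0 < len w by have := le_lt_trans lr1 lr2; rewrite ltrDl.
pose s := (r - lo w) / len w.
have [||y] := @before_cover w s.
- by rewrite divr_ge0// subr_ge0.
- by rewrite ltr_pdivrMr// mul1r ltrBlDl.
rewrite /s ler_pdivlMr// ltr_pdivrMr// => /andP[h1 h2].
by exists y; rewrite /=; apply/andP; split; lra.
Qed.

Let cell_uniq w y z r : cell (y :: w) r -> cell (z :: w) r -> y = z.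
Proof.
have H (a b : S) : (enum_rank a < enum_rank b)%N ->
    cell (a :: w) r -> cell (b :: w) r -> False.
  move=> /(@before_next w a b) ab; rewrite /cell/= => /andP[_ h1] /andP[h2 _].
  have := ler_wpM2l (len_ge0 w) ab; lra.
move=> cy cz; have [yz|zy|/ord_inj/enum_rank_inj//] := ltngtP (enum_rank y) (enum_rank z).
- by case: (H _ _ yz).
- by case: (H _ _ zy).
Qed.

Let draw w r := odflt x [pick y | cell (y :: w) r].
Fixpoint hist n t := if n is m.+1 then draw (hist m t) (unif t) :: hist m t else [::].
Let xi n t := head x (hist n t).

Let size_hist n t : size (hist n t) = n.
Proof. by elim: n => //= n ->. Qed.

Let drawE w y r : cell (y :: w) r -> draw w r = y.
Proof.
rewrite /draw => cy; case: pickP => [z /= cz|/(_ y)]; last by rewrite cy.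
exact: cell_uniq cz cy.
Qed.

Let hist_cell n t : cell (hist n t) (unif t).
Proof.
elim: n => [|n IH /=]; first by rewrite /cell/= add0r.
by have [y cy] := cell_split IH; rewrite (drawE cy).
Qed.

Let cell_hist n w t : size w = n -> cell w (unif t) -> hist n t = w.
Proof.
elim: n w => [|n IH] [|y w]//= [sw] cyw.
by rewrite (IH w)// ?(drawE cyw)//; exact: cell_sub cyw.
Qed.

Let lo_ge0 w : 0 <= lo w.
Proof. by elim: w => //= y w IH; rewrite addr_ge0// mulr_ge0. Qed.

Let hi_le1 w : lo w + len w <= 1.
Proof.
elim: w => [|y w]; first by rewrite add0r.
apply: le_trans; rewrite /= -addrA -mulrDr lerD2l.
by rewrite ler_piMr.
Qed.

Let cellE w : [set t | cell w (unif t)] = unif @^-1` `[lo w, lo w + len w[%classic.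
Proof. by apply/seteqP; split=> t; rewrite /= in_itv. Qed.

(** The word of length [n] drawn is [w] exactly when the uniform variable falls
    in the cell of [w]. *)
Let hist_law n w : size w = n -> P (hist n @^-1` [set w]) = (len w)%:E.
Proof.
move=> sw; rewrite (_ : _ @^-1` _ = [set t | cell w (unif t)]).
  by rewrite cellE unif_law// ?lerDl// addrC addKr.
by apply/seteqP; split=> t /= => [<-|]; [exact: hist_cell | exact: cell_hist].
Qed.

Let measurable_cell w : measurable [set t | cell w (unif t)].
Proof. by rewrite cellE -[_ @^-1` _]setTI; apply: measurable_unif. Qed.

Let measurable_draw w y : measurable ((draw w \o unif) @^-1` [set y]).
Proof.
rewrite (_ : _ @^-1` _ = [set t | cell (y :: w) (unif t)] `|`
   (if y == x then \bigcap_(z in [set: S]) ~` [set t | cell (z :: w) (unif t)]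
    else set0)).
  apply: measurableU; first exact: measurable_cell.
  case: ifP => // _; apply: fin_bigcap_measurable; first exact: finite_finset.
  by move=> z _; apply: measurableC; exact: measurable_cell.
apply/seteqP; split=> t /=.
  rewrite /draw; case: pickP => [z cz <-|none <-]; first by left.
  by right; rewrite eqxx => z _ /=; rewrite none.
move=> [|]; first exact: drawE.
case: ifP => // /eqP -> none; rewrite /draw; case: pickP => // z cz.
by case: (none z I).
Qed.

Let measurable_hist n w : measurable (hist n @^-1` [set w]).
Proof.
elim: n w => [|n IH] w.
  case: w => [|y w]; first by rewrite (_ : _ @^-1` _ = setT)//; apply/seteqP; split.
  by rewrite (_ : _ @^-1` _ = set0)//; apply/seteqP; split.
case: w => [|y w].
  by rewrite (_ : _ @^-1` _ = set0)//; apply/seteqP; split.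
rewrite (_ : _ @^-1` _ = (hist n @^-1` [set w]) `&` ((draw w \o unif) @^-1` [set y])).
  by apply: measurableI => //; exact: measurable_draw.
by apply/seteqP; split=> t /=; [case=> <- <-|move=> [-> ->]].
Qed.

Let word n t : n.-tuple S := Tuple (introT eqP (size_hist n t)).

Let wordE n t (s : n.-tuple S) : (word n t = s) <-> (hist n t = s).
Proof. by split=> [<-//|h]; exact: val_inj. Qed.

Let measurable_word n s : measurable (word n @^-1` [set s]).
Proof.
rewrite (_ : _ @^-1` _ = hist n @^-1` [set val s]); first exact: measurable_hist.
by apply/seteqP; split=> t /= /wordE.
Qed.

Let hist_past n k t t' : (k <= n)%N -> hist n t = hist n t' -> hist k t = hist k t'.
Proof.
move=> kn; rewrite -(subnKC kn) addnC; elim: (n - k)%N => //= j IH.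
by move=> [_ /IH].
Qed.

Let xi_trajectory n k t : (k <= n)%N -> xi k t = trajectory (hist n t) k.
Proof.
elim: n => [|n IH]; first by rewrite leqn0 => /eqP ->.
rewrite leq_eqVlt => /orP[/eqP ->|].
  rewrite /xi /trajectory /= rev_cons nth_rcons size_rev size_hist ltnn eqxx.
  by [].
rewrite ltnS => kn; rewrite (IH kn) /trajectory /= rev_cons -rcons_cons nth_rcons.
by rewrite /= size_rev size_hist ltnS kn.
Qed.

Let u1 n t := a1 n (xi ^~ t).
Let u2 n t := a2 n (xi ^~ t).

Let control_hist a n t : nonanticipating a ->
  a n (xi ^~ t) = a (size (hist n t)) (trajectory (hist n t)).
Proof. by move=> past; rewrite size_hist; apply: past => k; exact: xi_trajectory. Qed.

Let measurable_word_fun n (f : n.-tuple S -> R) : measurable_fun setT (f \o word n).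
Proof.
apply: (measurable_finite_choice (measurable_word (n := n)) (h := fun s _ => f s)) => s.
exact: measurable_cst.
Qed.

(** Since the controls are functions of the past states, every event of the
    history up to [n] is a union of cells of words of length [n]. *)
Let history_hist n A : <<s history_events xi u1 u2 n >> A ->
  forall t t', hist n t = hist n t' -> A t -> A t'.
Proof.
pose G := [set B : set T | forall t t', hist n t = hist n t' -> (B t <-> B t')].
suff sG : <<s history_events xi u1 u2 n >> `<=` G by move=> hA t t' /(sG A hA)[].
apply: smallest_sub.
  split=> [t t' _|B GB t t' e|F GF t t' e].
  - by split.
  - by split=> -[_ nB]; split=> // /(GB _ _ e).
  - by split=> -[i _ Fi]; exists i => //; apply/(GF i _ _ e).
have xiP k t t' : (k <= n)%N -> hist n t = hist n t' -> xi k t = xi k t'.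
  by move=> kn e; rewrite /xi (hist_past kn e).
move=> _ [k kn [[s ->]|[B _ ->]|[B _ ->]]] t t' e /=.
- by rewrite (xiP k t t').
- rewrite /u1 (a1_past (Y := xi ^~ t'))// => j jk.
  by apply: xiP => //; exact: leq_trans kn.
- rewrite /u2 (a2_past (Y := xi ^~ t'))// => j jk.
  by apply: xiP => //; exact: leq_trans kn.
Qed.

Let chain_admissible : admissible U1 U2 p P xi u1 u2.
Proof.
have mxi n s : measurable (xi n @^-1` [set s]).
  rewrite (_ : _ @^-1` _ = word n @^-1` [set v | head x v = s]); last by [].
  exact: measurable_finite_preimage (measurable_word (n := n)) _.
have mu a n : nonanticipating a -> measurable_fun setT (fun t => a n (xi ^~ t)).
  move=> past; rewrite (_ : (fun t => _) =
    (fun v : n.-tuple S => a (size v) (trajectory v)) \o word n).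
    exact: measurable_word_fun.
  by apply/funext => t; rewrite control_hist.
split=> //.
- by move=> n; split; exact: mu.
- by move=> n t; split; [exact: a1_in | exact: a2_in].
move=> n y A hA.
have mA : measurable A.
  move: A hA; apply: smallest_sub; first exact: sigma_algebra_measurable.
  move=> _ [k _ [[s ->]|[B mB ->]|[B mB ->]]]; first exact: mxi.
    by rewrite -[_ @^-1` _]setTI; apply: mu.
  by rewrite -[_ @^-1` _]setTI; apply: mu.
(* Both sides are computed word by word. *)
pose qy (v : n.-tuple S) := q v y; pose one (v : n.-tuple S) : R := 1.
have -> : (\int[P]_(t in A) (p (xi n t) y (u1 n t) (u2 n t))%:E)%E =
    (\int[P]_(t in A) (qy (word n t))%:E)%E.
  apply: eq_integral => t _; congr (_%:E).
  by rewrite /u1 /u2 (control_hist _ _ a1_past) (control_hist _ _ a2_past).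
rewrite (integral_finite_valued (measurable_word (n := n)) _ (V := qy))//; last first.
  by move=> v; exact: q_ge0.
have mB : measurable (A `&` xi n.+1 @^-1` [set y]) by apply: measurableI.
have -> : P (A `&` xi n.+1 @^-1` [set y]) =
    (\int[P]_(t in A `&` xi n.+1 @^-1` [set y])
      (one (word n t))%:E)%E.
  by rewrite -[LHS]mul1e -integral_cst.
rewrite (integral_finite_valued (measurable_word (n := n)) _ (V := one))//.
apply: eq_bigr => v _; rewrite mul1e.
have [[t [At tv]]|none] := pselect (A `&` word n @^-1` [set v] !=set0); last first.
  have e : A `&` word n @^-1` [set v] = set0.
    by apply/seteqP; split=> // t [At tv]; apply: none; exists t.
  by rewrite setIAC e set0I !measure0 mule0.
have AE t' : hist n t' = v -> A t'.
  move=> e; have H := @history_hist n A hA t t'; apply: H At.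
  by rewrite e; apply/wordE.
have e1 : A `&` word n @^-1` [set v] = hist n @^-1` [set val v].
  apply/seteqP; split=> t' /= => [[_ /wordE//]|e].
  by split; [exact: AE|apply/wordE].
have e2 : A `&` xi n.+1 @^-1` [set y] `&` word n @^-1` [set v] =
    hist n.+1 @^-1` [set y :: v].
  apply/seteqP; split=> t' /=.
    by move=> [[_ <-] /wordE <-].
  by move=> [dy e]; split; [split; [exact: AE|]|apply/wordE].
rewrite e1 e2; transitivity (len (y :: v))%:E.
  by apply: hist_law; rewrite /= size_tuple.
rewrite /= mulrC EFinM; congr (_ * _)%E; apply/esym/hist_law.
by rewrite size_tuple.
Qed.

Lemma chain_exists_on : exists xi : nat -> T -> S,
  admissible U1 U2 p P xi (fun n t => a1 n (xi ^~ t)) (fun n t => a2 n (xi ^~ t)) /\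
  forall t, xi 0%N t = x.
Proof. by exists xi. Qed.

End ChainExistence.

Lemma uniform_variable_exists (R : realType) :
  exists (d : measure_display) (T : measurableType d) (P : probability T R)
    (unif : T -> R), [/\ measurable_fun setT unif, forall t, 0 <= unif t < 1 &
    forall a b, 0 <= a -> a <= b -> b <= 1 ->
      P (unif @^-1` `[a, b[%classic) = (b - a)%:E].
Proof.
pose unif (t : measurableTypeR R) : R := if 0 <= t < 1 then t else 0.
exists _, _, uniform01, unif; split.
- apply: measurable_fun_ifT => //; apply: (measurable_fun_bool true).
  rewrite setTI (_ : _ @^-1` _ = `[0 : R, 1[%classic).
    exact: measurable_itv.
  by apply/seteqP; split=> t; rewrite /= in_itv.
- by move=> t; rewrite /unif; case: ifP => //; rewrite lexx ltr01.
- move=> a b a0 ab b1.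
  change (lebesgue_measure ((unif @^-1` `[a, b[%classic) `&` `[0 : R, 1[%classic) =
    (b - a)%:E).
  rewrite (_ : _ `&` _ = `[a, b[%classic).
    rewrite lebesgue_measure_itv/= lte_fin -EFinB.
    by case: ltgtP ab => // -> _; rewrite subrr.
  apply/seteqP; split=> t /=; rewrite !in_itv/= /unif.
    by case: ifPn => [_ []//|/negP nt [_ t01]]; case: nt.
  move=> /andP[ta tb]; case: ifPn => [t01|/negP[]].
    by split; rewrite // ta tb.
  by rewrite (le_trans a0)// (lt_le_trans tb).
Qed.

(** Rules that are functions of the past states are followed by some admissible
    chain from any initial state. *)
Theorem controlled_chain_exists {R : realType} {S : finType} (U1 U2 : set R)
    (p : S -> S -> R -> R -> R) (x : S) (a1 a2 : nat -> (nat -> S) -> R) :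
  transition_probability U1 U2 p ->
  (forall n X, U1 (a1 n X)) -> (forall n X, U2 (a2 n X)) ->
  nonanticipating a1 -> nonanticipating a2 ->
  exists (d : measure_display) (T : measurableType d) (P : probability T R)
    (xi : nat -> T -> S),
  admissible U1 U2 p P xi (fun n w => a1 n (xi ^~ w)) (fun n w => a2 n (xi ^~ w)) /\
  forall w, xi 0%N w = x.
Proof.
move=> pt a1U a2U na1 na2.
have [d [T [P [unif [mU U01 U_law]]]]] := uniform_variable_exists R.
exists d, T, P; exact: (chain_exists_on pt mU U01 U_law).
Qed.

(** * A potential contracted by all controls *)

Section OptimalSurvival.
Context {R : realType} {S : finType} (dS : {set S}).
Variables (U1 U2 : set R) (p : S -> S -> R -> R -> R) (n : nat) (gamma : R).
Hypotheses (U1_compact : compact U1) (U1_nonempty : U1 !=set0).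
Hypotheses (U2_compact : compact U2) (U2_nonempty : U2 !=set0).
Hypothesis p_transition : transition_probability U1 U2 p.
Hypothesis dS_absorbing : absorbing_set dS U1 U2 p.
Hypothesis p_cont : forall x y, continuous_on_controls U1 U2 (p x y).
Hypotheses (n_ge1 : (1 <= n)%N) (gamma_gt0 : 0 < gamma).
Hypothesis absorption : uniformly_absorbing dS U1 U2 p n gamma.

Lemma expected_next_absorbed (V : S -> R) x r1 r2 :
  x \in dS -> U1 r1 -> U2 r2 -> expected_next p V x r1 r2 = V x.
Proof.
move=> xdS Ur1 Ur2; have [p0] := p_transition x Ur1 Ur2.
have pxx := dS_absorbing xdS Ur1 Ur2.
rewrite /expected_next (bigD1 x)//= pxx => sum1.
have zero : \sum_(y | y != x) p x y r1 r2 = 0.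
  by move: sum1; rewrite -[RHS]addr0 => /addrI.
rewrite (bigD1 x)//= pxx mul1r big1 ?addr0// => y yx.
move: zero => /eqP; rewrite psumr_eq0//.
move=> /allP/(_ y (mem_index_enum y)); rewrite yx/= => /eqP ->.
by rewrite mul0r.
Qed.

Section Survival.
Variables b1 b2 : (S -> R) -> S -> R.
Hypothesis b_best : forall V x, [/\ U1 (b1 V x), U2 (b2 V x) &
  forall r1 r2, U1 r1 -> U2 r2 ->
    expected_next p V x r1 r2 <= expected_next p V x (b1 V x) (b2 V x)].

(** The largest probability, over all policies, of being outside [dS] after
    [m] steps. *)
Let survival m : S -> R :=
  iter m (fun V x => expected_next p V x (b1 V x) (b2 V x)) (fun x => (x \notin dS)%:R).

Let survival01 m x : 0 <= survival m x <= 1.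
Proof.
elim: m x => [|m IH] x /=; first by case: (_ \notin _); rewrite ?lexx ler01.
have [Ub1 Ub2 _] := b_best (survival m) x; have [p0 p1] := p_transition x Ub1 Ub2.
apply/andP; split.
  by apply: sumr_ge0 => y _; rewrite mulr_ge0//; case/andP: (IH y).
rewrite -p1; apply: ler_sum => y _; rewrite ler_piMr//.
by case/andP: (IH y).
Qed.

Let survival_absorbed m x : x \in dS -> survival m x = 0.
Proof.
move=> xdS; elim: m => [|m IH] /=; first by rewrite xdS.
by have [Ub1 Ub2 _] := b_best (survival m) x; rewrite expected_next_absorbed.
Qed.

Let survival_le m x r1 r2 : U1 r1 -> U2 r2 ->
  expected_next p (survival m) x r1 r2 <= survival m.+1 x.
Proof. by move=> Ur1 Ur2; have [_ _] := b_best (survival m) x; exact. Qed.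

(** The maximizing policy is realized by an actual controlled chain, to which
    the absorption hypothesis applies. *)
Let survival_n x : survival n x <= 1 - gamma.
Proof.
pose a1 k (X : nat -> S) := b1 (survival (n - k.+1)) (X k).
pose a2 k (X : nat -> S) := b2 (survival (n - k.+1)) (X k).
have [d [T [P [xi [adm xi0]]]]] : exists (d : measure_display)
    (T : measurableType d) (P : probability T R) (xi : nat -> T -> S),
    admissible U1 U2 p P xi (fun n w => a1 n (xi ^~ w)) (fun n w => a2 n (xi ^~ w)) /\
    forall w, xi 0%N w = x.
  apply: controlled_chain_exists => //.
  - by move=> k X; have [] := b_best (survival (n - k.+1)) (X k).
  - by move=> k X; have [] := b_best (survival (n - k.+1)) (X k).
  - by move=> k X Y XY; rewrite /a1 XY.
  - by move=> k X Y XY; rewrite /a2 XY.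
have surv0 m y : 0 <= survival m y by case/andP: (survival01 m y).
have step k : (k <= n)%N ->
    (\int[P]_w (survival (n - k) (xi k w))%:E = (survival n x)%:E)%E.
  elim: k => [_|k IH kn].
    rewrite subn0 (eq_integral (cst (survival n x)%:E)); last first.
      by move=> w _; rewrite xi0.
    by rewrite integral_cst// -[RHS]mule1; congr (_ * _)%E; exact: probability_setT.
  rewrite -(IH (ltnW kn)).
  rewrite (integral_next p_transition p_cont adm)//; last exact: history_setT.
  by apply: eq_integral => w _; rewrite -[in RHS]subnSK.
have := step _ (leqnn n); rewrite subnn => surv_n.
have mA : measurable (xi n @^-1` [set s | s \in dS]).
  exact: (measurable_finite_preimage (measurable_state adm n)).
have PE : (\int[P]_w (survival 0 (xi n w))%:E = P (~` (xi n @^-1` [set s | s \in dS])))%E.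
  rewrite -[in RHS](setIT (~` _)) -integral_indic//; last exact: measurableC.
  apply: eq_integral => w _ /=; congr (_%:E); rewrite indicE.
  congr ((nat_of_bool _)%:R); apply/idP/idP; first by move=> /negP h; rewrite inE.
  by rewrite inE => /negP.
have := absorption adm xi0.
rewrite -lee_fin -surv_n PE probability_setC// EFinB => ga.
by apply: leeB.
Qed.

(** For the sum of [survival m] over [m < n], the bound on the expected change in
    one step telescopes to [survival n - survival 0], which is at most [- gamma]
    off [dS]; as the sum is at most [n], this is a contraction. *)
Lemma survival_potential : exists (phi : S -> R) (rho : R),
  [/\ forall y, 0 <= phi y, forall y, y \notin dS -> 1 <= phi y, 0 <= rho < 1 &
      forall y r1 r2, U1 r1 -> U2 r2 -> expected_next p phi y r1 r2 <= rho * phi y].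
Proof.
pose phi y := \sum_(m < n) survival m y.
have surv0 m y : 0 <= survival m y by case/andP: (survival01 m y).
have phi0 y : 0 <= phi y by apply: sumr_ge0.
have n0 : 0 < n%:R :> R by rewrite ltr0n.
have phin y : phi y <= n%:R.
  rewrite -[n in leRHS]card_ord -sum1_card natr_sum.
  by apply: ler_sum => m _; case/andP: (survival01 m y).
have drift y r1 r2 : U1 r1 -> U2 r2 ->
    expected_next p phi y r1 r2 <= phi y - survival 0 y + survival n y.
  move=> Ur1 Ur2; apply: (@le_trans _ _ (\sum_(m < n) survival m.+1 y)).
    rewrite /expected_next /phi; under eq_bigr do rewrite mulr_sumr.
    by rewrite exchange_big/=; apply: ler_sum => m _; exact: survival_le.
  have e1 : \sum_(m < n.+1) survival m y = survival 0 y + \sum_(m < n) survival m.+1 y.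
    by rewrite big_ord_recl.
  have e2 : \sum_(m < n.+1) survival m y = phi y + survival n y by rewrite big_ord_recr.
  by move: e1; rewrite e2 => e1; move: e1; set s := \sum_(m < n) _; lra.
exists phi, (Num.max 0 (1 - gamma / n%:R)); split => //.
- move=> y out; rewrite /phi -(prednK n_ge1) big_ord_recl.
  have -> : survival ord0 y = 1 by rewrite /survival/= out.
  by rewrite lerDl; apply: sumr_ge0 => m _; exact: surv0.
- by rewrite le_max lexx/= gt_max ltr01 gtrBl divr_gt0.
move=> y r1 r2 Ur1 Ur2; have [ydS|out] := boolP (y \in dS).
  rewrite expected_next_absorbed//.
  have -> : phi y = 0 by rewrite /phi big1// => m _; exact: survival_absorbed.
  by rewrite mulr0.
apply: le_trans (drift _ _ _ Ur1 Ur2) _.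
apply: (@le_trans _ _ ((1 - gamma / n%:R) * phi y)); last first.
  by apply: ler_wpM2r => //; rewrite le_max lexx orbT.
have := survival_n y; have -> : survival 0 y = 1 by rewrite /survival/= out.
have : gamma / n%:R * phi y <= gamma.
  rewrite -mulrA ler_piMr ?(ltW gamma_gt0)// mulrC ler_pdivrMr// mul1r.
  exact: phin.
lra.
Qed.

End Survival.

Lemma absorption_potential : exists (phi : S -> R) (rho : R),
  [/\ forall y, 0 <= phi y, forall y, y \notin dS -> 1 <= phi y, 0 <= rho < 1 &
      forall y r1 r2, U1 r1 -> U2 r2 -> expected_next p phi y r1 r2 <= rho * phi y].
Proof.
have best (Vx : (S -> R) * S) : exists b : R * R, [/\ U1 b.1, U2 b.2 &
    forall r1 r2, U1 r1 -> U2 r2 ->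
      expected_next p Vx.1 Vx.2 r1 r2 <= expected_next p Vx.1 Vx.2 b.1 b.2].
  have [r1 Ur1] := U1_nonempty; have [r2 Ur2] := U2_nonempty.
  have [||| b [Ub1 Ub2] bmax] := @compact_argmax R _ (U1 `*` U2)
    (fun r => expected_next p Vx.1 Vx.2 r.1 r.2).
  - exact: compact_setX.
  - by exists (r1, r2).
  - have cE : continuous_on_controls U1 U2 (expected_next p Vx.1 Vx.2).
      by apply: expected_next_continuous => y; exact: p_cont.
    exact: cE.
  by exists b; split=> // s1 s2 Us1 Us2; exact: (bmax (s1, s2)).
have [b bP] := choice best.
apply: (@survival_potential (fun V x => (b (V, x)).1) (fun V x => (b (V, x)).2)).
by move=> V x; exact: (bP (V, x)).
Qed.

End OptimalSurvival.

(** * Solving the Isaacs equation by value iteration *)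

Section Value.
Context {R : realType} {S : finType} (dS : {set S}).
Variables (U1 U2 : set R) (p : S -> S -> R -> R -> R).
Variables (c : S -> R -> R -> R) (g : S -> R) (phi : S -> R) (rho C : R).
Hypothesis p_transition : transition_probability U1 U2 p.
Hypothesis c_ge0 : forall x r1 r2, U1 r1 -> U2 r2 -> 0 <= c x r1 r2.
Hypothesis c_le : forall x r1 r2, U1 r1 -> U2 r2 -> c x r1 r2 <= C.
Hypothesis g_ge0 : forall x, 0 <= g x.
Hypothesis phi_ge0 : forall y, 0 <= phi y.
Hypothesis phi_ge1 : forall y, y \notin dS -> 1 <= phi y.
Hypothesis rho01 : 0 <= rho < 1.
Hypothesis C_ge0 : 0 <= C.
Hypothesis phi_contract : forall y r1 r2, U1 r1 -> U2 r2 ->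
  expected_next p phi y r1 r2 <= rho * phi y.
Variables a b : (S -> R) -> S -> R.
Hypothesis ab_saddle : forall V x, (forall y, 0 <= V y) ->
  saddle_point U1 U2 (stage_cost p c V x) (a V x) (b V x).
Implicit Types V : S -> R.

Let nonneg V := forall y, 0 <= V y.
Let val V x := stage_cost p c V x (a V x) (b V x).

(** Playing each optimal control against the other one's game shows that the
    value is monotone and nonexpansive. *)
Let val_le V V' x e : nonneg V -> nonneg V' ->
  (forall r1 r2, U1 r1 -> U2 r2 ->
     stage_cost p c V x r1 r2 <= stage_cost p c V' x r1 r2 + e) ->
  val V x <= val V' x + e.
Proof.
move=> V0 V'0 VV'.
have [_ Ub _ h1] := ab_saddle x V0; have [Ua' _ h2 _] := ab_saddle x V'0.
apply: le_trans (h1 _ Ua') _; apply: le_trans (VV' _ _ Ua' Ub) _.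
by rewrite lerD2r; exact: h2.
Qed.

Let stage_ge0 V x r1 r2 : nonneg V -> U1 r1 -> U2 r2 -> 0 <= stage_cost p c V x r1 r2.
Proof.
move=> V0 Ur1 Ur2; have [p0 _] := p_transition x Ur1 Ur2.
by apply: addr_ge0; [exact: c_ge0 | apply: sumr_ge0 => y _; exact: mulr_ge0].
Qed.

Let isaacs V x := if x \in dS then g x else val V x.

Let value_iter k : S -> R := iter k isaacs (fun x => if x \in dS then g x else 0).

Let value_iter_ge0 k : nonneg (value_iter k).
Proof.
elim: k => [|k IH] x /=; first by case: ifP.
rewrite /isaacs; case: ifP => // _.
by have [Ua Ub _ _] := ab_saddle x IH; exact: stage_ge0.
Qed.

Let value_iter_le k x : value_iter k x <= value_iter k.+1 x.
Proof.
elim: k x => [|k IH] x /=; rewrite /isaacs; case: ifP => // _.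
  have V0 := value_iter_ge0 0.
  by have [Ua Ub _ _] := ab_saddle x V0; exact: stage_ge0.
rewrite -[leRHS]addr0; apply: val_le; [exact: value_iter_ge0|exact: (value_iter_ge0 k.+1)|].
move=> r1 r2 Ur1 Ur2; rewrite addr0 lerD2l; apply: ler_sum => y _.
by have [p0 _] := p_transition x Ur1 Ur2; apply: ler_wpM2l.
Qed.

(** The potential turns the running cost bound into a supersolution: one step
    costs at most [C], and off [dS] the function [C / (1 - rho) * phi] drops by
    at least [C] on average. *)
Let value_iter_bounded k x :
  value_iter k x <= \sum_y g y + C / (1 - rho) * phi x.
Proof.
have [r0 r1] := andP rho01; have q0 : 0 < 1 - rho by rewrite subr_gt0.
set K := C / (1 - rho); set G := \sum_y g y.
have K0 : 0 <= K by rewrite divr_ge0// ltW.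
have KE : K * (1 - rho) = C by rewrite /K divfK// gt_eqF.
have G0 : 0 <= G by apply: sumr_ge0.
have gG y : g y <= G by rewrite /G (bigD1 y)//= lerDl; apply: sumr_ge0.
have bound y : y \in dS -> g y <= G + K * phi y.
  by move=> _; apply: le_trans (gG y) _; rewrite lerDl mulr_ge0.
elim: k x => [|k IH] x /=.
  by case: ifP => [/bound//|_]; rewrite addr_ge0// mulr_ge0.
rewrite /isaacs; case: ifPn => [/bound//|out].
have [Ua Ub _ _] := ab_saddle x (value_iter_ge0 k).
have [p0 p1] := p_transition x Ua Ub.
rewrite /val /stage_cost /expected_next; set r := a _ _ in Ua p0 p1 *; set s := b _ _ in Ub p0 p1 *.
have h1 : \sum_y p x y r s * value_iter k y <= G + K * (rho * phi x).
  apply: (@le_trans _ _ (\sum_y (p x y r s * G + K * (p x y r s * phi y)))).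
    apply: ler_sum => y _; rewrite mulrCA -mulrDr.
    by apply: ler_wpM2l => //; exact: IH.
  rewrite big_split/= -mulr_suml p1 mul1r lerD2l -mulr_sumr.
  by apply: ler_wpM2l => //; exact: phi_contract.
have h2 := c_le x Ua Ub; have h3 := phi_ge1 out.
have h4 : C <= C * phi x by rewrite ler_peMr.
have h5 : K * phi x = K * (rho * phi x) + C * phi x by rewrite -KE; ring.
rewrite h5; lra.
Qed.

Let cvg_value x : exists l, (fun k => value_iter k x) @ \oo --> l /\
  forall k, value_iter k x <= l.
Proof.
have nd : nondecreasing_seq (fun k => value_iter k x).
  by apply/nondecreasing_seqP => k; exact: value_iter_le.
have ub : has_ubound (range (fun k => value_iter k x)).
  by exists (\sum_y g y + C / (1 - rho) * phi x) => _ [k _ <-]; exact: value_iter_bounded.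
exists (sup (range (fun k => value_iter k x))); split; first exact: nondecreasing_cvgn.
by move=> k; apply: ub_le_sup => //; exists k.
Qed.

(** The iterates increase to a limit [V]. Monotonicity of the value gives one
    inequality; the other holds up to the sum of the gaps between [V] and an
    iterate, which tends to zero. *)
Lemma isaacs_fixpoint : exists V, [/\ nonneg V, forall x, x \in dS -> V x = g x &
  forall x, x \notin dS -> val V x = V x].
Proof.
have [V VP] := choice cvg_value.
have V0 : nonneg V.
  by move=> x; apply: le_trans (value_iter_ge0 0 x) _; have [_] := VP x; exact.
exists V; split=> // x.
  move=> xdS; have [cV _] := VP x.
  apply: (@cvg_unique _ _ (value_iter ^~ x @ \oo)) => //.
  apply: cvg_near_cst; apply: nearW => -[|k] /=; first by rewrite xdS.
  by rewrite /isaacs xdS.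
move=> out; apply/eqP; rewrite eq_le; apply/andP; split; last first.
  have [cV _] := VP x; apply: (cvgr_to_le cV).
  apply: nearW => -[|k] /=.
    rewrite (negbTE out); have [Ua Ub _ _] := ab_saddle x V0; exact: stage_ge0.
  rewrite /isaacs (negbTE out) -[leRHS]addr0; apply: val_le => // r1 r2 Ur1 Ur2.
  rewrite addr0 lerD2l; apply: ler_sum => y _.
  have [p0 _] := p_transition x Ur1 Ur2.
  by apply: ler_wpM2l => //; have [_] := VP y; exact.
have gap k : val V x <= V x + \sum_y (V y - value_iter k y).
  apply: (@le_trans _ _ (val (value_iter k) x + \sum_y (V y - value_iter k y))).
    apply: val_le => // r1 r2 Ur1 Ur2; have [p0 p1] := p_transition x Ur1 Ur2.
    rewrite /stage_cost /expected_next -addrA lerD2l -big_split/=; apply: ler_sum => y _.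
    have Vk : value_iter k y <= V y by have [_] := VP y; exact.
    have p_le1 : p x y r1 r2 <= 1.
      by rewrite -p1 (bigD1 y)//= lerDl sumr_ge0.
    have := p0 y; nra.
  rewrite lerD2r; have [_ /(_ k.+1)] := VP x.
  by rewrite /= /isaacs (negbTE out).
have gap0 : (fun k => V x + \sum_y (V y - value_iter k y)) @ \oo --> V x + \sum_(y : S) 0.
  apply: cvgD; first exact: cvg_cst.
  apply: (@cvg_big _ _ _ _ _ add_continuous) => y _.
  rewrite -(subrr (V y)); apply: cvgB; first exact: cvg_cst.
  by have [] := VP y.
rewrite big1// addr0 in gap0.
by apply: (cvgr_to_ge gap0); apply: nearW.
Qed.

End Value.

(** * Stationary saddle rules *)

Section Strategies.
Context {R : realType} {S : finType} (dS : {set S}).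
Variables (U1 U2 : set R) (p : S -> S -> R -> R -> R).
Variables (c : S -> R -> R -> R) (g : S -> R).
Hypothesis p_transition : transition_probability U1 U2 p.
Hypothesis p_cont : forall x y, continuous_on_controls U1 U2 (p x y).
Hypothesis c_ge0 : forall x r1 r2, U1 r1 -> U2 r2 -> 0 <= c x r1 r2.
Hypothesis c_cont : forall x, continuous_on_controls U1 U2 (c x).
Hypothesis g_ge0 : forall x, 0 <= g x.

Definition stationary_rules last (s : S -> R) : rules last :=
  fun n xs _ _ => s (tnth xs ord_max).

Lemma stationary_controls last (U : set R) (s : S -> R) : (forall x, U (s x)) ->
  controls last U (stationary_rules (last := last) s).
Proof. by move=> sU n xs; split=> [|own opp]; [exact: measurable_cst | exact: sU]. Qed.

Lemma stationary_follows last (s : S -> R) (T : Type) (xi : nat -> T -> S)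
    (own opp : nat -> T -> R) :
  follows (stationary_rules (last := last) s) xi own opp <->
  forall n w, own n w = s (xi n w).
Proof.
split=> H n w; first by rewrite H /stationary_rules tnth_mktuple.
by rewrite /stationary_rules tnth_mktuple H.
Qed.

(** Against an opponent who uses the stationary rule [s], the rules [F] reduce
    to functions of the trajectory, whatever the order of play. *)
Fixpoint past_controls last (F : rules last) (s : S -> R) (X : nat -> S) n : n.-tuple R :=
  if n is m.+1 then [tuple of rcons (past_controls F s X m)
    (F m [tuple X k | k < m.+1] (past_controls F s X m) [tuple s (X k) | k < m + last])]
  else [tuple].

Definition control_along last (F : rules last) (s : S -> R) n (X : nat -> S) : R :=
  F n [tuple X k | k < n.+1] (past_controls F s X n) [tuple s (X k) | k < n + last].

Lemma past_controlsE last (F : rules last) s X n :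
  past_controls F s X n = [tuple control_along F s k X | k < n].
Proof.
suff H i : (i < n)%N -> nth 0 (past_controls F s X n) i = control_along F s i X.
  by apply: eq_from_tnth => i; rewrite tnth_mktuple (tnth_nth 0) H.
elim: n i => // n IH i; rewrite ltnS /= nth_rcons size_tuple leq_eqVlt.
by case: ltngtP => //= [lt_in _|-> _ //]; exact: IH.
Qed.

Lemma control_along_past last (F : rules last) s : nonanticipating (control_along F s).
Proof.
have args n X Y : (forall k, (k <= n)%N -> X k = Y k) ->
    [tuple X k | k < n.+1] = [tuple Y k | k < n.+1] /\
    [tuple s (X k) | k < n + last] = [tuple s (Y k) | k < n + last].
  move=> XY; split; apply: eq_from_tnth => i; rewrite !tnth_mktuple XY//.
    by rewrite -ltnS.
  by rewrite -ltnS (leq_trans (ltn_ord i))// -[leqRHS]addn1 leq_add2l leq_b1.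
have past n X Y : (forall k, (k <= n)%N -> X k = Y k) ->
    past_controls F s X n = past_controls F s Y n.
  elim: n => // n IH XY; apply: val_inj => /=.
  have XYn k : (k <= n)%N -> X k = Y k by move=> kn; apply: XY; exact: leqW.
  by have [-> ->] := args _ _ _ XYn; rewrite IH.
move=> n X Y XY; rewrite /control_along.
by have [-> ->] := args _ _ _ XY; rewrite (past _ _ _ XY).
Qed.

Section Guarantees.
Variables (V : S -> R) (s1 s2 : S -> R).
Hypothesis V_ge0 : forall y, 0 <= V y.
Hypothesis V_boundary : forall y, y \in dS -> V y = g y.
Hypothesis V_saddle : forall y, saddle_point U1 U2 (stage_cost p c V y) (s1 y) (s2 y).
Hypothesis V_fix : forall y, y \notin dS -> stage_cost p c V y (s1 y) (s2 y) = V y.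
Variables (phi : S -> R) (rho : R).
Hypothesis phi_ge0 : forall y, 0 <= phi y.
Hypothesis phi_ge1 : forall y, y \notin dS -> 1 <= phi y.
Hypothesis rho01 : 0 <= rho < 1.
Hypothesis phi_contract : forall y r1 r2, U1 r1 -> U2 r2 ->
  expected_next p phi y r1 r2 <= rho * phi y.

Lemma W_stationary1_le last1 last2 x (G : rules last2) :
  (W dS U1 U2 p c g x (stationary_rules (last := last1) s1) G <= (V x)%:E)%E.
Proof.
apply: ge_ereal_sup => e [d [T [P [xi [u1 [u2 [adm xi0 follow1 _ ->]]]]]]].
apply: (total_cost_le p_transition p_cont c_ge0 c_cont g_ge0 adm xi0) => // k w out.
have /stationary_follows -> := follow1.
have [_ _ best2 _] := V_saddle (xi k w).
by rewrite -[leRHS]V_fix//; apply: best2; have [] := controls_in adm k w.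
Qed.

(** [W] is a supremum over chains, so the lower bound needs a chain that follows
    both rules. *)
Lemma W_stationary2_ge last1 last2 x (F : rules last1) : controls last1 U1 F ->
  ((V x)%:E <= W dS U1 U2 p c g x F (stationary_rules (last := last2) s2))%E.
Proof.
move=> FU.
have [d [T [P [xi [adm xi0]]]]] : exists (d : measure_display)
    (T : measurableType d) (P : probability T R) (xi : nat -> T -> S),
    admissible U1 U2 p P xi (fun n w => control_along F s2 n (xi ^~ w))
      (fun n w => s2 (xi n w)) /\ forall w, xi 0%N w = x.
  apply: (@controlled_chain_exists R S U1 U2 p x (control_along F s2)
    (fun n X => s2 (X n))) => //.
  - by move=> n X; have [_] := FU n [tuple X k | k < n.+1]; exact.
  - by move=> n X; have [_] := V_saddle (X n).
  - exact: control_along_past.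
  - by move=> n X Y XY; rewrite XY.
apply: le_trans (ereal_sup_ubound _); last first.
  exists d, T, P, xi, (fun n w => control_along F s2 n (xi ^~ w)), (fun n w => s2 (xi n w)).
  split=> //; last exact/stationary_follows.
  by move=> n w; rewrite {1}/control_along past_controlsE.
apply: (total_cost_ge p_transition p_cont c_ge0 c_cont g_ge0 adm xi0 V_ge0 V_boundary
  phi_ge0 phi_ge1 rho01 phi_contract) => k w out.
have [_ _ _ best1] := V_saddle (xi k w).
by rewrite -[leLHS]V_fix//; apply: best1; have [] := controls_in adm k w.
Qed.

End Guarantees.
End Strategies.

Lemma running_cost_bounded {R : realType} {S : finType} (U1 U2 : set R)
    (c : S -> R -> R -> R) : compact U1 -> U1 !=set0 -> compact U2 -> U2 !=set0 ->
  (forall x r1 r2, U1 r1 -> U2 r2 -> 0 <= c x r1 r2) ->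
  (forall x, continuous_on_controls U1 U2 (c x)) ->
  exists2 C, 0 <= C & forall x r1 r2, U1 r1 -> U2 r2 -> c x r1 r2 <= C.
Proof.
move=> cU1 [u1 U1u] cU2 [u2 U2u] c0 cc.
have /choice[M MP] x : exists M, 0 <= M /\ forall r1 r2, U1 r1 -> U2 r2 -> c x r1 r2 <= M.
  have [||| b [Ub1 Ub2] bmax] := @compact_argmax R _ (U1 `*` U2) (fun r => c x r.1 r.2).
  - exact: compact_setX.
  - by exists (u1, u2).
  - exact: cc.
  exists (c x b.1 b.2); split; first exact: c0.
  by move=> r1 r2 Ur1 Ur2; exact: (bmax (r1, r2)).
have M0 x : 0 <= M x by have [] := MP x.
exists (\sum_x M x); first by apply: sumr_ge0.
move=> x r1 r2 Ur1 Ur2; have [_ /(_ _ _ Ur1 Ur2) cM] := MP x.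
apply: le_trans cM _; rewrite (bigD1 x)//= lerDl.
by apply: sumr_ge0.
Qed.

Theorem mainTheorem1 (R : realType) (S : finType) (dS : {set S})
  (U1 U2 : set R) (p : S -> S -> R -> R -> R) (c : S -> R -> R -> R)
  (g : S -> R) (n : nat) (gamma : R)
  (U1_compact : compact U1) (U1_nonempty : U1 !=set0)
  (U2_compact : compact U2) (U2_nonempty : U2 !=set0)
  (p_transition : transition_probability U1 U2 p)
  (dS_absorbing : absorbing_set dS U1 U2 p)
  (c_ge0 : forall x r1 r2, U1 r1 -> U2 r2 -> 0 <= c x r1 r2)
  (c_continuous : forall x, continuous_on_controls U1 U2 (c x))
  (g_ge0 : forall x, 0 <= g x)
  (n_ge1 : (1 <= n)%N) (gamma_gt0 : 0 < gamma)
  (absorption : uniformly_absorbing dS U1 U2 p n gamma)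
  (H12 : H1 U1 U2 p c \/ H2 U1 U2 p c) :
  forall x : S,
    [/\ exists2 F, controls false U1 F &
          worst_cost1 dS U1 U2 p c g x F = upper_value dS U1 U2 p c g x,
        exists2 G, controls false U2 G &
          worst_cost2 dS U1 U2 p c g x G = lower_value dS U1 U2 p c g x &
        upper_value dS U1 U2 p c g x = lower_value dS U1 U2 p c g x].
Proof.
have p_cont := p_continuous U1_compact U1_nonempty U2_compact U2_nonempty
  p_transition H12.
have [phi [rho [phi0 phi1 rho01 phi_contract]]] := absorption_potential
  U1_compact U1_nonempty U2_compact U2_nonempty p_transition dS_absorbing p_cont
  n_ge1 gamma_gt0 absorption.
have [C C0 cC] := running_cost_bounded U1_compact U1_nonempty U2_compact
  U2_nonempty c_ge0 c_continuous.
(* Controls are selected for every [V] at once; only nonnegative [V] occur in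
   value iteration, so the others get the dummy pair [(0, 0)]. *)
have saddles (Vx : (S -> R) * S) : exists ab : R * R, (forall y, 0 <= Vx.1 y) ->
    saddle_point U1 U2 (stage_cost p c Vx.1 Vx.2) ab.1 ab.2.
  have [V0|nV0] := pselect (forall y, 0 <= Vx.1 y); last by exists (0, 0).
  have [a [b ab]] := stage_saddle U1_compact U1_nonempty U2_compact U2_nonempty
    p_transition c_continuous H12 Vx.2 V0.
  by exists (a, b).
have [ab abP] := choice saddles.
have [V [V0 VdS Vfix]] := isaacs_fixpoint (a := fun V x => (ab (V, x)).1)
  (b := fun V x => (ab (V, x)).2) p_transition c_ge0 cC g_ge0 phi0 phi1 rho01 C0
  phi_contract (fun V x => abP (V, x)).
pose s1 x := (ab (V, x)).1; pose s2 x := (ab (V, x)).2.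
have V_saddle y : saddle_point U1 U2 (stage_cost p c V y) (s1 y) (s2 y).
  exact: (abP (V, y)).
have s1U y : U1 (s1 y) by have [] := V_saddle y.
have s2U y : U2 (s2 y) by have [] := V_saddle y.
move=> x.
have le1 last1 last2 (G : rules last2) := W_stationary1_le p_transition p_cont c_ge0
  c_continuous g_ge0 V0 VdS V_saddle Vfix last1 x G.
have ge2 last1 last2 (F : rules last1) (FU : controls last1 U1 F) :=
  W_stationary2_ge p_transition p_cont c_ge0
  c_continuous g_ge0 V0 VdS V_saddle Vfix phi0 phi1 rho01 phi_contract
  last2 x FU.
pose F0 := stationary_rules (last := false) s1.
pose G0 := stationary_rules (last := false) s2.
have F0U : controls false U1 F0 by exact: stationary_controls.
have G0U : controls false U2 G0 by exact: stationary_controls.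
have upper F : controls false U1 F -> ((V x)%:E <= worst_cost1 dS U1 U2 p c g x F)%E.
  move=> FU; apply: le_trans (ge2 _ true _ FU) (ereal_sup_ubound _).
  by exists (stationary_rules s2) => //; exact: stationary_controls.
have lower G : controls false U2 G -> (worst_cost2 dS U1 U2 p c g x G <= (V x)%:E)%E.
  move=> GU; apply: le_trans (ereal_inf_lbound _) (le1 true _ G).
  by exists (stationary_rules s1) => //; exact: stationary_controls.
have worst1 : worst_cost1 dS U1 U2 p c g x F0 = (V x)%:E.
  apply/eqP; rewrite eq_le upper// andbT.
  by apply: ge_ereal_sup => _ [G _ <-]; exact: le1.
have worst2 : worst_cost2 dS U1 U2 p c g x G0 = (V x)%:E.
  apply/eqP; rewrite eq_le lower//=.
  by apply: le_ereal_inf_tmp => _ [F FU <-]; exact: ge2.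
have upperE : upper_value dS U1 U2 p c g x = (V x)%:E.
  apply/eqP; rewrite eq_le; apply/andP; split.
    by rewrite -worst1; apply: ereal_inf_lbound; exists F0.
  by apply: le_ereal_inf_tmp => _ [F FU <-]; exact: upper.
have lowerE : lower_value dS U1 U2 p c g x = (V x)%:E.
  apply/eqP; rewrite eq_le; apply/andP; split.
    by apply: ge_ereal_sup => _ [G GU <-]; exact: lower.
  by rewrite -worst2; apply: ereal_sup_ubound; exists G0.
by split; [exists F0; rewrite ?upperE | exists G0; rewrite ?lowerE | rewrite upperE].
Qed.
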